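(* There exist universal constants $c,C>0$ such that the following holds. Let $X$ be an irreducible, transitive, reversible and lazy Markov chain on $n\ge 2$ states, with eigenvalues $1=\lambda_1>\lambda_2\ge\cdots\ge\lambda_n$ (with multiplicity), and let $Q=\sum_{j=2}^{n}(1-\lambda_j)^{-2}$. Then $$c\sqrt{Q}\le t_{\mathrm I}\le C\sqrt{Q},$$ and for every state $x$, $$c\, n\sum_{i=0}^{t_{\mathrm{unif}}}\sum_{j=0}^{t_{\mathrm{unif}}}p_{i+j}(x,x)\;\le\; Q\;\le\; C\, n\sum_{i=0}^{t_{\mathrm{unif}}}\sum_{j=0}^{t_{\mathrm{unif}}}p_{i+j}(x,x).$$
   Context: All chains are in discrete time. A chain is lazy if its transition matrix has the form $(P+I)/2$ for some stochastic matrix $P$, where $I$ is the identity matrix. A chain on a state space $E$ with transition probabilities $p$ is transitive if for any $x,y\in E$ there is a bijection $\varphi:E\to E$ with $\varphi(x)=y$ and $p(z,w)=p(\varphi(z),\varphi(w))$ for all $z,w\in E$. The eigenvalues $\lambda_j$ are those of the transition matrix of the (lazy) chain, $p_t(x,y)$ are its $t$-step transition probabilities, and $\pi$ is its stationary distribution. Uniform mixing time: $t_{\mathrm{unif}}=\inf\{t\ge 0:\max_{x,y}|p_t(x,y)/\pi(y)-1|\le 1/4\}$ (over integers $t$). Intersection time: let $X,Y$ be two independent chains with the given transition matrix and let $\tau_I=\inf\{t\ge 0:\{X_0,\ldots,X_t\}\cap\{Y_0,\ldots,Y_t\}\ne\varnothing\}$. Then $t_{\mathrm I}=\max_{x,y}\mathbb{E}_{x,y}[\tau_I]$,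 where $\mathbb{E}_{x,y}$ is expectation when $X_0=x$, $Y_0=y$. *)

(* Defs.v *)
From HB Require Import structures.
From mathcomp Require Import all_boot all_order all_algebra.
From mathcomp Require Import all_classical all_reals all_analysis.
Set Implicit Arguments.
Unset Strict Implicit.
Unset Printing Implicit Defensive.
Import Order.TTheory GRing.Theory Num.Theory.
Import numFieldNormedType.Exports.
Local Open Scope classical_set_scope.
Local Open Scope ring_scope.

(* A chain on n states is given by its transition matrix, indexed by 'I_n;
   its t-step transition probabilities are the entries of P ^+ t. *)
Section Chain.
Variables (R : realType) (n : nat).
Implicit Types (P : 'M[R]_n) (pi : 'rV[R]_n).

Definition stochastic P : Prop :=
  (forall x y, 0 <= P x y) /\ (forall x, \sum_y P x y = 1).

Definition irreducible P : Prop := forall x y, exists t : nat, 0 < (P ^+ t) x y.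

Definition lazy P : Prop :=
  exists P0 : 'M[R]_n, stochastic P0 /\ P = 2^-1 *: (P0 + 1%:M).

Definition transitive_chain P : Prop :=
  forall x y, exists phi : 'I_n -> 'I_n,
    [/\ bijective phi, phi x = y & forall z w, P z w = P (phi z) (phi w)].

Definition stationary P pi : Prop :=
  [/\ forall x, 0 <= pi ord0 x, \sum_x pi ord0 x = 1 & pi *m P = pi].

Definition reversible P pi : Prop :=
  forall x y, pi ord0 x * P x y = pi ord0 y * P y x.

(* lam lists the eigenvalues with algebraic multiplicity in nonincreasing
   order; the top eigenvalue has index 0. *)
Definition ordered_eigenvalues P (lam : n.-tuple R) : Prop :=
  char_poly P = \prod_(l <- lam) ('X - l%:P) /\ sorted >=%R lam.

Definition eigenvalue_sum (lam : n.-tuple R) : R :=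
  \sum_(j < n | (0 < j)%N) (1 - tnth lam j) ^- 2.

Definition unif_dist P pi (t : nat) : R :=
  \big[Num.max/0]_(x < n) \big[Num.max/0]_(y < n)
    `|(P ^+ t) x y / pi ord0 y - 1|.

(* The least t with unif_dist at most 1/4 (and 0 if there is none, which does
   not occur for an irreducible lazy chain). *)
Definition t_unif P pi : nat :=
  xget 0%N [set t : nat | unif_dist P pi t <= 4^-1 /\
    forall s : nat, unif_dist P pi s <= 4^-1 -> (t <= s)%N].

Definition double_green_sum P pi (x : 'I_n) : R :=
  \sum_(i < (t_unif P pi).+1) \sum_(j < (t_unif P pi).+1) (P ^+ (i + j)) x x.

End Chain.

Section Process.
Variables (R : realType) (n : nat) (d : measure_display).
Variable Omega : measurableType d.
Implicit Types (P : 'M[R]_n) (X Y : nat -> Omega -> 'I_n).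
Implicit Type mu : probability Omega R.

Definition path_event X (t : nat) (u : nat -> 'I_n) : set Omega :=
  [set w | forall s : nat, (s <= t)%N -> X s w = u s].

(* The Markov property is written in product form, which avoids conditioning
   on null events. *)
Definition markov_chain_from mu P (x : 'I_n) X : Prop :=
  [/\ forall t y, measurable (X t @^-1` [set y]),
      mu (X 0%N @^-1` [set x]) = 1%E
    & forall (t : nat) (u : nat -> 'I_n),
        mu (path_event X t.+1 u) =
        (mu (path_event X t u) * (P (u t) (u t.+1))%:E)%E].

(* Path events form a pi-system generating the sigma-algebra of a process (up
   to the empty set), so this is independence of the two processes. *)
Definition independent_processes mu X Y : Prop :=
  forall (s t : nat) (u v : nat -> 'I_n),
    mu (path_event X s u `&` path_event Y t v) =
    (mu (path_event X s u) * mu (path_event Y t v))%E.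

Definition independent_chains_from mu P (x y : 'I_n) X Y : Prop :=
  [/\ markov_chain_from mu P x X, markov_chain_from mu P y Y
    & independent_processes mu X Y].

(* The value is +oo when the two trajectories never intersect. *)
Definition tau_I X Y (w : Omega) : \bar R :=
  ereal_inf [set t%:R%:E | t in [set t : nat |
    exists i j : nat, [/\ (i <= t)%N, (j <= t)%N & X i w = Y j w]]].

(* Pr x y plays the role of the law under which X starts at x and Y at y. *)
Definition t_I (Pr : 'I_n -> 'I_n -> probability Omega R) X Y : \bar R :=
  \big[Order.max/0%E]_(x < n) \big[Order.max/0%E]_(y < n)
    (\int[Pr x y]_w tau_I X Y w)%E.

End Process.

(* Main.v *)
Require Import Defs.
From HB Require Import structures.
From mathcomp Require Import all_boot all_order all_algebra.
From mathcomp Require Import all_classical all_reals all_analysis.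
From mathcomp Require Import ring lra zify.
Import Order.TTheory GRing.Theory Num.Theory.
Import numFieldNormedType.Exports.
Local Open Scope classical_set_scope.
Local Open Scope ring_scope.

(* Write G_N for the common diagonal value of g_N ^ 2, g_N = sum_(i <= N) P ^ i.
   By transitivity n G_N is the trace of g_N ^ 2, that is
   (N+1)^2 + sum_(j >= 2) (sum_(i <= N) lambda_j ^ i) ^ 2 <= (N+1)^2 + Q.
   At time T = t_unif all lambda_j ^ T are at most 1/4, which gives
   Q <= (16/9) n G_T, while the minimality of T gives T ^ 2 <= 16 Q.

   Let Z count the pairs i, j <= N with X_i = Y_j. From uniform starting points
   E Z = (N+1)^2 / n and E Z^2 <= (4/n) (N+1)^2 G_N.
   Upper bound on t_I: for N about sqrt Q the second moment method makes the
   walks meet with probability at least 1/8; after a burn-in of T steps the same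
   holds, up to a constant, from every pair of starting points, and one iterates
   over blocks of length T + N <= 5 sqrt Q.
   Lower bound on t_I: an eigenfunction f for lambda stays positive, resp.
   negative, up to time t with probability at least lambda ^ t from its maximum,
   resp. minimum, so t_I >= c / (1 - lambda). If all these bounds are much
   smaller than sqrt Q, then n G_L >= Q / 4 for L about sqrt Q / 100. When the
   walks meet by time L, the two-parameter martingale
   E[Z_2L | X_0, ..., X_i, Y_0, ..., Y_j] reaches G_L, and Doob's L^2 inequality
   applied in X and then in Y (Cairoli) bounds the probability of this event by
   16 E Z_2L ^ 2 / G_L ^ 2 <= 1 / 2. *)

Set Implicit Arguments.
Unset Strict Implicit.
Unset Printing Implicit Defensive.

(** * Expectations along paths *)

Section PathExpectation.
Variables (R : realType) (n : nat) (P : 'M[R]_n).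
Implicit Types (N : nat) (x y u v : 'I_n) (s t : seq 'I_n) (f g : seq 'I_n -> R).

(* Expectation of f (X_0, ..., X_N) for the chain started at x. *)
Fixpoint pathE N x f : R :=
  if N is N'.+1 then \sum_y P x y * pathE N' y (fun s => f (x :: s))
  else f [:: x].

Lemma eq_pathE N x f g : (forall s, size s = N -> f (x :: s) = g (x :: s)) ->
  pathE N x f = pathE N x g.
Proof.
elim: N x f g => [|N IHN] x f g fg /=; first exact: fg.
apply: eq_bigr => y _; congr (_ * _); apply: IHN => s sN.
by apply: fg; rewrite /= sN.
Qed.

Lemma pathED N x f g :
  pathE N x (fun s => f s + g s) = pathE N x f + pathE N x g.
Proof.
elim: N x f g => [|N IHN] x f g //=.
by rewrite -big_split; apply: eq_bigr => y _ /=; rewrite IHN mulrDr.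
Qed.

Lemma pathEZ N x a f : pathE N x (fun s => a * f s) = a * pathE N x f.
Proof.
elim: N x f => [|N IHN] x f //=.
by rewrite mulr_sumr; apply: eq_bigr => y _ /=; rewrite IHN mulrCA.
Qed.

Lemma pathEB N x f g :
  pathE N x (fun s => f s - g s) = pathE N x f - pathE N x g.
Proof.
rewrite -mulN1r -pathEZ -pathED; apply: eq_pathE => s _.
by rewrite mulN1r.
Qed.

Lemma pathE_sum N x (I : Type) (r : seq I) (A : pred I) (F : I -> seq 'I_n -> R) :
  pathE N x (fun s => \sum_(i <- r | A i) F i s) =
  \sum_(i <- r | A i) pathE N x (F i).
Proof.
elim: N x F => [|N IHN] x F //=.
under eq_bigr => y _ do rewrite IHN mulr_sumr.
by rewrite exchange_big.
Qed.

Lemma pathE_last N x (h : 'I_n -> R) :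
  pathE N x (fun s => h (last x s)) = \sum_u (P ^+ N) x u * h u.
Proof.
elim: N x => [|N IHN] x /=.
  rewrite expr0 (bigD1 x) //= !mxE eqxx mul1r big1 ?addr0 // => u /negPf ux.
  by rewrite !mxE eq_sym ux mul0r.
under eq_bigr => y _.
  rewrite (@eq_pathE _ _ _ (fun s => h (last y s))) // IHN mulr_sumr.
  over.
rewrite exchange_big /=; apply: eq_bigr => u _.
rewrite exprS mxE mulr_suml; apply: eq_bigr => y _.
by rewrite mulrA.
Qed.

Lemma pathE_swap M N x y (F : seq 'I_n -> seq 'I_n -> R) :
  pathE M x (fun s => pathE N y (fun t => F s t)) =
  pathE N y (fun t => pathE M x (fun s => F s t)).
Proof.
elim: M x F => [|M IHM] x F //=.
rewrite pathE_sum; apply: eq_bigr => z _.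
by rewrite pathEZ IHM.
Qed.

(** Markov property at time M. The second piece begins with the state at which the first one ends,
    so [take M] drops that shared state from the first piece, which has M + 1 entries. *)
Lemma pathE_cat M N x f :
  pathE (M + N) x f =
  pathE M x (fun s => pathE N (last x s) (fun t => f (take M s ++ t))).
Proof.
elim: M x f => [|M IHM] x f //=.
apply: eq_bigr => y _; congr (_ * _); rewrite IHM.
exact: eq_pathE.
Qed.

Definition green N : 'M[R]_n := \sum_(i < N.+1) P ^+ i.

Lemma greenS N : green N.+1 = 1 + P *m green N.
Proof.
rewrite /green big_ord_recl expr0; congr (_ + _).
by rewrite mulmx_sumr; apply: eq_bigr => i _; rewrite exprS.
Qed.

Hypothesis Pst : stochastic P.

Lemma pathE_le N x f g : (forall s, size s = N -> f (x :: s) <= g (x :: s)) ->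
  pathE N x f <= pathE N x g.
Proof.
elim: N x f g => [|N IHN] x f g fg /=; first exact: fg.
apply: ler_sum => y _; apply: ler_wpM2l; first exact: Pst.1.
by apply: IHN => s sN; apply: fg; rewrite /= sN.
Qed.

Lemma pathE_cst N x a : pathE N x (fun=> a) = a.
Proof.
elim: N x => [|N IHN] x //=.
by under eq_bigr do rewrite IHN; rewrite -mulr_suml Pst.2 mul1r.
Qed.

Lemma pathE_ge0 N x f : (forall s, size s = N -> 0 <= f (x :: s)) ->
  0 <= pathE N x f.
Proof. by move=> f0; rewrite -(pathE_cst N x 0); exact: pathE_le. Qed.

Lemma pathE_count N x u :
  pathE N x (fun s => (count_mem u s)%:R) = green N x u.
Proof.
elim: N x => [|N IHN] x /=.
  by rewrite /green big_ord1 expr0 addn0 mxE.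
rewrite greenS mxE.
transitivity (\sum_y (P x y * (x == u)%:R + P x y * green N y u)).
  apply: eq_bigr => y _; rewrite -mulrDr -IHN -[(x == u)%:R](pathE_cst N y).
  by rewrite -pathED; congr (_ * _); apply: eq_pathE => s _; rewrite natrD.
rewrite big_split /= -mulr_suml Pst.2 mul1r mxE; congr (_ + _).
by rewrite mxE.
Qed.

Lemma pathE_take M N x f :
  pathE (M + N) x (fun s => f (take M.+1 s)) = pathE M x f.
Proof.
elim: M x f => [|M IHM] x f.
  rewrite add0n /= -[RHS](pathE_cst N x); apply: eq_pathE => s _ /=.
  by rewrite take0.
rewrite addSn /=; apply: eq_bigr => y _; congr (_ * _).
by rewrite -IHM.
Qed.

End PathExpectation.

(** * Doob's inequality *)

Section Doob.
Variables (R : realType) (n : nat) (P : 'M[R]_n).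
Hypothesis Pst : stochastic P.
Implicit Types (N : nat) (x y u v : 'I_n) (s t : seq 'I_n) (f g : seq 'I_n -> R).

(* Running maximum along s of the martingale E[f | X_0, ..., X_i]. *)
Fixpoint doob f s : R :=
  if s is x :: s' then
    Num.max (pathE P (size s') x f) (doob (fun t => f (x :: t)) s')
  else 0.

Lemma doob_ge0 f s : 0 <= doob f s.
Proof. by elim: s f => [|x s IHs] f //=; rewrite le_max IHs orbT. Qed.

Lemma le_doob f s u t :
  pathE P (size t) u (fun r => f (s ++ r)) <= doob f (s ++ u :: t).
Proof.
elim: s f => [|x s IHs] f /=; first by rewrite le_max lexx.
by rewrite le_max (IHs (fun r => f (x :: r))) orbT.
Qed.

(* For a martingale M with running maximum S, the process
   S_k^2 - 2 M_k S_k is nonincreasing in mean. *)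
Lemma doob_aux N x f (S : R) : 0 <= S ->
  let M0 := pathE P N x f in let S0 := Num.max S M0 in
  pathE P N x (fun s => Num.max S (doob f s) ^+ 2) <=
  S0 ^+ 2 - 2 * M0 * S0 + 2 * pathE P N x (fun s => f s * Num.max S (doob f s)).
Proof.
elim: N x f S => [|N IHN] x f S S_ge0; cbv zeta;
  set M0 := pathE P _ x f; set S0 := Num.max S M0.
  rewrite /S0 /M0 /=.
  have -> : Num.max S (Num.max (f [:: x]) 0) = Num.max S (f [:: x]).
    by rewrite maxCA (max_l S_ge0) maxC.
  by rewrite mulrA subrK.
rewrite [X in X <= _]/= [X in _ + 2 * X]/=.
have S0_ge0 : 0 <= S0 by rewrite le_max S_ge0.
pose f' t := f (x :: t).
have E s : size s = N.+1 -> Num.max S (doob f (x :: s)) = Num.max S0 (doob f' s).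
  by move=> sN; rewrite /S0 -maxA; congr Num.max; rewrite [LHS]/= sN.
have -> : \sum_y P x y * pathE P N y (fun s => Num.max S (doob f (x :: s)) ^+ 2)
  = \sum_y P x y * pathE P N y (fun s => Num.max S0 (doob f' s) ^+ 2).
  by apply: eq_bigr => y _; congr (_ * _); apply: eq_pathE => s sN; rewrite E //= sN.
have -> : \sum_y P x y * pathE P N y (fun s => f (x :: s) * Num.max S (doob f (x :: s)))
  = \sum_y P x y * pathE P N y (fun s => f' s * Num.max S0 (doob f' s)).
  by apply: eq_bigr => y _; congr (_ * _); apply: eq_pathE => s sN; rewrite E //= sN.
pose M1 y := pathE P N y f'.
have -> : S0 ^+ 2 - 2 * M0 * S0 = \sum_y P x y * (S0 ^+ 2 - 2 * M1 y * S0).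
  under eq_bigr do rewrite mulrBr.
  rewrite big_split /= -mulr_suml Pst.2 mul1r; congr (_ + _).
  have -> : M0 = \sum_y P x y * M1 y by [].
  rewrite sumrN -mulrA mulr_suml mulr_sumr; congr (- _).
  by apply: eq_bigr => y _; ring.
rewrite mulr_sumr -big_split /=; apply: ler_sum => y _.
rewrite mulrCA -mulrDr ler_wpM2l ?Pst.1 //.
apply: le_trans (IHN y f' S0 S0_ge0) _; rewrite lerD2r -/(M1 y).
(* If the maximum rises from S0 to M1, the two sides differ by (S0 - M1)^2. *)
have [_|_] := leP (M1 y) S0 => //.
have := sqr_ge0 (S0 - M1 y); nra.
Qed.

(** Started from S = 0, [doob_aux] gives E D^2 <= 2 E (f D) for the maximum D, because S0^2 - 2 M0
    S0 <= 0. Then 2 f D <= 2 f^2 + D^2 / 2 absorbs half of the left side, whence the constant 4. *)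
Lemma doob_L2 N x f :
  pathE P N x (fun s => doob f s ^+ 2) <= 4 * pathE P N x (fun s => f s ^+ 2).
Proof.
have := @doob_aux N x f 0 (lexx 0); rewrite /=.
set M0 := pathE P N x f => H.
have D0 s : Num.max 0 (doob f s) = doob f s by rewrite max_r ?doob_ge0.
have {}H : pathE P N x (fun s => doob f s ^+ 2) <=
    2 * pathE P N x (fun s => f s * doob f s).
  move: H; rewrite (@eq_pathE _ _ _ _ _ _ (fun s => doob f s ^+ 2)); last first.
    by move=> s _; rewrite D0.
  rewrite [X in _ <= _ + 2 * X](@eq_pathE _ _ _ _ _ _ (fun s => f s * doob f s)); last first.
    by move=> s _; rewrite D0.
  move=> H; apply: le_trans H _; rewrite gerDr.
  by have [M_ge0|M_lt0] := leP 0 M0; rewrite ?mulr0; nra.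
have : 2 * pathE P N x (fun s => f s * doob f s) <=
    2 * pathE P N x (fun s => f s ^+ 2) + 2^-1 * pathE P N x (fun s => doob f s ^+ 2).
  rewrite -!pathEZ -pathED; apply: (pathE_le Pst) => s _.
  by have := sqr_ge0 (2 * f (x :: s) - doob f (x :: s)); nra.
lra.
Qed.

End Doob.

(** * Two independent walks *)

Section TwoWalkers.
Variables (R : realType) (n : nat) (P : 'M[R]_n).
Hypothesis Pst : stochastic P.
Implicit Types (L N : nat) (x y u v : 'I_n) (s t : seq 'I_n).

Lemma stochastic_exp (Q : 'M[R]_n) k : stochastic Q -> stochastic (Q ^+ k).
Proof.
move=> [Q0 Q1]; elim: k => [|k [IH0 IH1]].
  split=> [x y|x]; first by rewrite expr0 mxE ler0n.
  rewrite expr0 (bigD1 x) //= mxE eqxx big1 ?addr0 // => y /negPf yx.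
  by rewrite mxE eq_sym yx.
split=> [x y|x].
  by rewrite exprS mxE sumr_ge0 // => z _; rewrite mulr_ge0.
under eq_bigr do rewrite exprS mxE.
rewrite exchange_big /=; under eq_bigr do rewrite -mulr_sumr IH1 mulr1.
exact: Q1.
Qed.

Lemma green_ge0 N x y : 0 <= green P N x y.
Proof.
by rewrite /green summxE sumr_ge0 // => i _; exact: (stochastic_exp i Pst).1.
Qed.

Lemma green_mono L N x y : (L <= N)%N -> green P L x y <= green P N x y.
Proof.
move=> LN; rewrite /green !summxE 
  (big_ord_widen N.+1 (fun i => (P ^+ i) x y) (LN : (L.+1 <= N.+1)%N)).
rewrite [leRHS](bigID (fun i : 'I_N.+1 => (i < L.+1)%N)) /= lerDl.
by rewrite sumr_ge0 // => i _; exact: (stochastic_exp i Pst).1.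
Qed.

Lemma sum_green N x : \sum_y green P N x y = N.+1%:R.
Proof.
under eq_bigr do rewrite /green summxE.
rewrite exchange_big /=; under eq_bigr do rewrite (stochastic_exp _ Pst).2.
by rewrite sumr_const card_ord.
Qed.

Definition meetings s t : R := \sum_u (count_mem u s)%:R * (count_mem u t)%:R.

Lemma pathE_meetings M N x y :
  pathE P M x (fun s => pathE P N y (fun t => meetings s t)) =
  \sum_u green P M x u * green P N y u.
Proof.
under eq_bigr => u _ do
  rewrite -[green P M x u](pathE_count Pst) -[green P N y u](pathE_count Pst).
rewrite /meetings (@eq_pathE _ _ _ _ _ _ (fun s => \sum_u
   pathE P N y (fun t => (count_mem u t)%:R) * (count_mem u s)%:R)).
  rewrite pathE_sum; apply: eq_bigr => u _.
  by rewrite pathEZ mulrC.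
move=> s _; rewrite pathE_sum; apply: eq_bigr => u _.
by rewrite pathEZ mulrC.
Qed.

(* Probability that walks started at x and y are disjoint up to time N. *)
Definition avoid N x y : R :=
  pathE P N x (fun s => pathE P N y (fun t => (~~ has (mem s) t)%:R)).

Lemma avoid_ge0 N x y : 0 <= avoid N x y.
Proof.
by apply: (pathE_ge0 Pst) => s _; apply: (pathE_ge0 Pst) => t _; rewrite ler0n.
Qed.

Lemma pathE_has N x y :
  pathE P N x (fun s => pathE P N y (fun t => (has (mem s) t)%:R)) =
  1 - avoid N x y.
Proof.
rewrite -{2}(pathE_cst Pst N x 1) /avoid -pathEB; apply: eq_pathE => s _.
rewrite -{2}(pathE_cst Pst N y 1) -pathEB; apply: eq_pathE => t _.
by case: (has _ _); rewrite ?subr0 ?subrr.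
Qed.

Lemma avoid_le1 N x y : avoid N x y <= 1.
Proof.
rewrite -subr_ge0 -pathE_has; apply: (pathE_ge0 Pst) => s _.
by apply: (pathE_ge0 Pst) => t _; rewrite ler0n.
Qed.

(** Disjoint long paths have disjoint initial pieces and disjoint final pieces. Meetings between an
    early state of one walk and a late state of the other are ignored, which costs only an
    inequality. *)
Lemma avoid_cat M N x y : avoid (M + N) x y <=
  pathE P M x (fun s => pathE P M y (fun t =>
    (~~ has (mem s) t)%:R * avoid N (last x s) (last y t))).
Proof.
rewrite /avoid pathE_cat; apply: (pathE_le Pst) => s sM.
rewrite [leLHS](@eq_pathE _ _ _ _ _ _ (fun s' => pathE P M y (fun t =>
  pathE P N (last y t) (fun t' =>
  (~~ has (mem (take M (x :: s) ++ s')) (take M t ++ t'))%:R)))); last first.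
  by move=> s' _; rewrite pathE_cat.
rewrite pathE_swap; apply: (pathE_le Pst) => t tM.
rewrite -pathEZ; apply: (pathE_le Pst) => s' s'N.
rewrite -pathEZ; apply: (pathE_le Pst) => t' t'N.
rewrite -natrM mulnb ler_nat.
have prefix_last z (r : seq 'I_n) : size r = M -> take M (z :: r) = belast z r.
  by move=> <-; rewrite lastI -cats1 -(size_belast z) take_size_cat.
rewrite !prefix_last //.
have sub1 z (r r' : seq 'I_n) :
    {subset z :: r <= belast z r ++ last z r :: r'}.
  by move=> w; rewrite lastI mem_rcons !(inE, mem_cat) => /orP[] ->; rewrite ?orbT.
have sub2 z (r r' : seq 'I_n) :
    {subset last z r :: r' <= belast z r ++ last z r :: r'}.
  by move=> w wr; rewrite mem_cat wr orbT.
have sub (A B A' B' : seq 'I_n) : {subset A <= A'} -> {subset B <= B'} ->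
    has (mem A) B -> has (mem A') B'.
  by move=> AA BB /hasP[w /BB wB /AA wA]; apply/hasP; exists w.
case E1: (has _ (y :: t)); first by rewrite (sub _ _ _ _ (@sub1 x s s') (@sub1 y t t') E1).
case E2: (has _ (_ :: t')); first by rewrite (sub _ _ _ _ (@sub2 x s s') (@sub2 y t t') E2).
by case: (has _ _).
Qed.

Lemma avoid_last M N x y :
  pathE P M x (fun s => pathE P M y (fun t => avoid N (last x s) (last y t))) =
  \sum_u \sum_v (P ^+ M) x u * (P ^+ M) y v * avoid N u v.
Proof.
pose h u := \sum_v (P ^+ M) y v * avoid N u v.
rewrite (@eq_pathE _ _ _ _ _ _ (fun s => h (last x s))); last first.
  by move=> s _; exact: (pathE_last P M y (avoid N (last x (x :: s)))).

rewrite (pathE_last P M x h); apply: eq_bigr => u _.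
by rewrite mulr_sumr; apply: eq_bigr => v _; rewrite mulrA.
Qed.

Hypothesis Psym : forall x y, P x y = P y x.

Lemma sym_exp k x y : (P ^+ k) x y = (P ^+ k) y x.
Proof.
elim: k x y => [|k IHk] x y; first by rewrite expr0 !mxE eq_sym.
by rewrite [in LHS]exprS [in RHS]exprSr !mxE; apply: eq_bigr => z _; rewrite IHk Psym mulrC.
Qed.

Lemma green_sym N x y : green P N x y = green P N y x.
Proof. by rewrite /green !summxE; apply: eq_bigr => i _; exact: sym_exp. Qed.

Lemma sum_green_sqr N x :
  \sum_y green P N x y ^+ 2 = (green P N *m green P N) x x.
Proof. by rewrite mxE; apply: eq_bigr => y _; rewrite (green_sym N y x). Qed.

(** Induction on the first state. Summing over all starting points is summing against an invariant
    measure, since P is symmetric, so the path without its first state contributes the same sum at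
    horizon N. Visits of the first state to u or v add at most 2 [green P N.+1 u v]. *)
Lemma pathE_count2 N u v :
  \sum_x pathE P N x (fun s => (count_mem u s)%:R * (count_mem v s)%:R) <=
  2 * N.+1%:R * green P N u v.
Proof.
elim: N => [|N IHN].
  rewrite /= (bigD1 u) //= big1 ?addr0 => [|x /negPf xu]; last first.
    by rewrite xu mul0r.
  rewrite eqxx mul1r /green big_ord1 expr0 !mxE addn0.
  by case: (u == v) => /=; rewrite ?mulr1 ?mulr0; lra.
pose F x y := pathE P N y (fun s => (count_mem u s)%:R * (count_mem v s)%:R) : R.
have H x : pathE P N.+1 x (fun s => (count_mem u s)%:R * (count_mem v s)%:R) <=
   (x == u)%:R * green P N.+1 x v + (x == v)%:R * green P N.+1 x u
   + \sum_y P x y * F x y.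
  rewrite -!(pathE_count Pst) -!pathEZ -pathED /= -big_split /=.
  apply: ler_sum => y _; rewrite -mulrDr ler_wpM2l ?Pst.1 //.
  rewrite -pathED; apply: (pathE_le Pst) => s _ /=.
  rewrite !natrD; have : 0 <= (x == u)%:R * (x == v)%:R :> R by rewrite mulr_ge0.
  by nra.
apply: le_trans (ler_sum _ (fun x _ => H x)) _.
rewrite !big_split /=.
have E1 a b : \sum_x (x == a)%:R * green P N.+1 x b = green P N.+1 a b.
  rewrite (bigD1 a) //= eqxx mul1r big1 ?addr0 // => x /negPf xa.
  by rewrite xa mul0r.
rewrite !E1 exchange_big /=.
have -> : \sum_y \sum_x P x y * F x y = \sum_y F y y.
  apply: eq_bigr => y _; rewrite -mulr_suml.
  by under eq_bigr do rewrite Psym; rewrite Pst.2 mul1r.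
have H1 := IHN; have H2 := green_mono u v (leqnSn N).
rewrite (green_sym _ v u).
have : 2 * N.+1%:R * green P N u v <= 2 * N.+1%:R * green P N.+1 u v.
  by rewrite ler_wpM2l // mulr_ge0.
by rewrite (natrD _ 1 N.+1); move: H1; rewrite /F; lra.
Qed.

(** Expand Z^2 as a double sum over u and v. The expectation factors by independence of the walks,
    and summing over both starting points yields the sum of K(u, v)^2, to which [pathE_count2]
    applies termwise. *)
Lemma meetings_L2 N :
  \sum_x \sum_y pathE P N x (fun s => pathE P N y (fun t => meetings s t ^+ 2))
  <= 4 * N.+1%:R ^+ 2 * \tr (green P N *m green P N).
Proof.
pose K u v : R := \sum_x pathE P N x (fun s => (count_mem u s)%:R * (count_mem v s)%:R).
have -> : \sum_x \sum_y pathE P N x (fun s => pathE P N y (fun t => meetings s t ^+ 2))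
   = \sum_u \sum_v K u v ^+ 2.
  pose a u v x := pathE P N x (fun s => (count_mem u s)%:R * (count_mem v s)%:R).
  have E x y : pathE P N x (fun s => pathE P N y (fun t => meetings s t ^+ 2)) =
     \sum_u \sum_v a u v x * a u v y.
    rewrite (@eq_pathE _ _ _ _ _ _ (fun s => \sum_u \sum_v
       a u v y * ((count_mem u s)%:R * (count_mem v s)%:R))); last first.
      move=> s _.
      rewrite (@eq_pathE _ _ _ _ _ _ (fun t => \sum_u \sum_v
        ((count_mem u (x :: s))%:R * (count_mem v (x :: s))%:R) *
        ((count_mem u t)%:R * (count_mem v t)%:R))); last first.
        move=> t _; rewrite /meetings expr2 mulr_suml; apply: eq_bigr => u _.
        by rewrite mulr_sumr; apply: eq_bigr => v _; ring.
      rewrite pathE_sum; apply: eq_bigr => u _.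
      rewrite pathE_sum; apply: eq_bigr => v _.
      by rewrite pathEZ mulrC.
    rewrite pathE_sum; apply: eq_bigr => u _.
    rewrite pathE_sum; apply: eq_bigr => v _.
    by rewrite pathEZ mulrC.
  under eq_bigr => x _ do under eq_bigr => y _ do rewrite E.
  under eq_bigr => x _.
    rewrite exchange_big /=; under eq_bigr => u _ do rewrite exchange_big /=.
    over.
  rewrite exchange_big /=; apply: eq_bigr => u _.
  rewrite exchange_big /=; apply: eq_bigr => v _.
  rewrite expr2 /K mulr_suml; apply: eq_bigr => x _.
  by rewrite mulr_sumr.
rewrite /mxtrace mulr_sumr; apply: ler_sum => u _.
rewrite -sum_green_sqr mulr_sumr; apply: ler_sum => v _.
have -> : 4 * N.+1%:R ^+ 2 * green P N u v ^+ 2 = (2 * N.+1%:R * green P N u v) ^+ 2.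
  by ring.
rewrite ler_sqr ?pathE_count2 // nnegrE.
  by apply: sumr_ge0 => x _; apply: (pathE_ge0 Pst) => s _; rewrite mulr_ge0.
by rewrite mulr_ge0 ?green_ge0 // mulr_ge0.
Qed.

Lemma sum_meetings N :
  \sum_x \sum_y pathE P N x (fun s => pathE P N y (fun t => meetings s t)) =
  n%:R * N.+1%:R ^+ 2.
Proof.
under eq_bigr => x _ do under eq_bigr => y _ do rewrite pathE_meetings.
under eq_bigr => x _ do rewrite exchange_big /=.
rewrite exchange_big /=.
transitivity (\sum_(u < n) (N.+1%:R ^+ 2 : R)); last first.
  by rewrite sumr_const card_ord [RHS]mulr_natl.
apply: eq_bigr => u _.
under eq_bigr => x _ do rewrite -mulr_sumr.
rewrite -mulr_suml expr2.
by under eq_bigr do rewrite green_sym; rewrite sum_green.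
Qed.

End TwoWalkers.

(** * Bounds on avoidance probabilities *)

Section Avoidance.
Variables (R : realType) (n : nat) (P : 'M[R]_n).
Hypothesis Pst : stochastic P.
Implicit Types (L M N : nat) (x y u v : 'I_n) (s t : seq 'I_n).

(** Doeblin minorization: at time T the law of the pair of walks dominates a^2 times counting
    measure, and only meetings after time T are taken into account. *)
Lemma avoid_mix T L (a : R) x y : 0 <= a -> (forall u v, a <= (P ^+ T) u v) ->
  avoid P (T + L) x y <= 1 - a ^+ 2 * \sum_u \sum_v (1 - avoid P L u v).
Proof.
move=> a_ge0 aP; apply: le_trans (avoid_cat Pst _ _ _ _) _.
have -> : 1 - a ^+ 2 * \sum_u \sum_v (1 - avoid P L u v) =
   \sum_u \sum_v ((P ^+ T) x u * (P ^+ T) y v - a ^+ 2 * (1 - avoid P L u v)).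
  under [RHS]eq_bigr do rewrite big_split /= -mulr_sumr (stochastic_exp T Pst).2 mulr1.
  rewrite big_split /= (stochastic_exp T Pst).2; congr (_ + _).
  by rewrite mulr_sumr -sumrN; apply: eq_bigr => u _; rewrite sumrN mulr_sumr.
apply: (@le_trans _ _ (\sum_u \sum_v (P ^+ T) x u * (P ^+ T) y v * avoid P L u v)).
  rewrite -avoid_last; apply: (pathE_le Pst) => s _; apply: (pathE_le Pst) => t _.
  by rewrite ler_piMl ?avoid_ge0 // lern1 leq_b1.
apply: ler_sum => u _; apply: ler_sum => v _.
have h1 := aP x u; have h2 := aP y v; have h3 := avoid_le1 Pst L u v.
have : a * a <= (P ^+ T) x u * (P ^+ T) y v by apply: ler_pM.
by move: ((P ^+ T) x u * _) => p; rewrite -subr_ge0 in h3; rewrite -expr2; nra.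
Qed.

(** Each block of M steps is survived with probability at most 1 - delta from any pair of states.
    The bound M / delta is the fixed point of v = M + (1 - delta) v, so it is preserved when one
    more block is put in front. *)
Lemma sum_avoid_le M (delta : R) : (0 < M)%N -> 0 < delta ->
  (forall x y, avoid P M x y <= 1 - delta) ->
  forall K x y, \sum_(i < K) avoid P i x y <= M%:R / delta.
Proof.
move=> M_gt0 d_gt0 Md.
suff H k x y : \sum_(i < k * M) avoid P i x y <= M%:R / delta.
  move=> K x y; apply: le_trans (H K x y).
  rewrite (big_ord_widen (K * M) (fun i => avoid P i x y)) ?leq_pmulr //.
  rewrite [leRHS](bigID (fun i : 'I_(K * M) => (i < K)%N)) /= lerDl.
  by apply: sumr_ge0 => i _; exact: avoid_ge0.
elim: k x y => [|k IHk] x y.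
  by rewrite mul0n big_ord0 divr_ge0 // ltW.
rewrite mulSn big_split_ord /=.
have -> : M%:R / delta = M%:R + (1 - delta) * (M%:R / delta) :> R.
  by field; rewrite gt_eqF.
apply: lerD.
  rewrite -[leRHS]mulr1 -[X in _ <= X%:R * _](card_ord M) mulr_natl -sumr_const.
  by apply: ler_sum => i _; exact: avoid_le1.
apply: (@le_trans _ _ (avoid P M x y * (M%:R / delta))); last first.
  by rewrite ler_wpM2r // divr_ge0 // ltW.
apply: (le_trans (ler_sum _ (fun (i : 'I_(k * M)) _ => avoid_cat Pst M i x y))).
rewrite -pathE_sum mulrC /avoid -pathEZ; apply: (pathE_le Pst) => s _.
rewrite -pathE_sum -pathEZ; apply: (pathE_le Pst) => t _.
by rewrite -mulr_sumr mulrC; apply: ler_wpM2r; [exact: ler0n | exact: IHk].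
Qed.

Section Eigenfunction.
Variable lam : R.
Hypothesis lam_ge0 : 0 <= lam.

(* lam ^- t * f (X_t) is a martingale; stop it when f (X_t) <= 0. *)
Lemma eigen_stay (f : 'I_n -> R) (M : R) :
  (forall x, \sum_y P x y * f y = lam * f x) -> 0 <= M -> (forall x, f x <= M) ->
  forall N x, lam ^+ N * f x <= M * pathE P N x (fun s => (all (fun z => 0 < f z) s)%:R).
Proof.
move=> Pf M_ge0 fM; elim=> [|N IHN] x.
  rewrite /= expr0 mul1r andbT; case: ltP => /= fx; first by rewrite mulr1.
  by rewrite mulr0.
have [fx|fx] := leP (f x) 0.
  apply: (@le_trans _ _ 0); first by rewrite mulr_ge0_le0 // exprn_ge0.
  by rewrite mulr_ge0 //; apply: (pathE_ge0 Pst) => s _; rewrite ler0n.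
rewrite exprSr -mulrA -Pf /= !mulr_sumr; apply: ler_sum => y _.
rewrite mulrCA [leRHS]mulrCA ler_wpM2l ?Pst.1 //; apply: le_trans (IHN y) _.
rewrite (@eq_pathE _ _ _ _ _ _ (fun s => (all (fun z => 0 < f z) s)%:R)) //.
by move=> s _; rewrite /= fx.
Qed.

(** One walk stays where f > 0 and the other where f < 0; these sets are disjoint and the walks are
    independent, so the two bounds of [eigen_stay] multiply. *)
Lemma eigen_avoid (f : 'I_n -> R) x y N :
  (forall z, \sum_w P z w * f w = lam * f z) ->
  (forall z, f z <= f x) -> (forall z, f y <= f z) -> 0 < f x -> f y < 0 ->
  lam ^+ N * lam ^+ N <= avoid P N x y.
Proof.
move=> Pf fx fy fx_gt0 fy_lt0.
pose up x := pathE P N x (fun s => (all (fun z => 0 < f z) s)%:R).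
pose down x := pathE P N x (fun s => (all (fun z => 0 < - f z) s)%:R).
have Hup : lam ^+ N <= up x.
  have := eigen_stay Pf (ltW fx_gt0) fx N x.
  by rewrite mulrC ler_pM2l.
have Hdown : lam ^+ N <= down y.
  have Pf' z : \sum_w P z w * (- f w) = lam * (- f z).
    by under eq_bigr do rewrite mulrN; rewrite sumrN Pf mulrN.
  have fy' z : - f z <= - f y by rewrite lerN2.
  have fy_gt0 : 0 < - f y by rewrite oppr_gt0.
  have := eigen_stay Pf' (ltW fy_gt0) fy' N y.
  by rewrite mulrC ler_pM2l.
apply: (@le_trans _ _ (up x * down y)); first by rewrite ler_pM ?exprn_ge0.
rewrite mulrC /up -pathEZ; apply: (pathE_le Pst) => s _.
rewrite mulrC /down -pathEZ; apply: (pathE_le Pst) => t _.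
rewrite -natrM mulnb ler_nat; set S := x :: s; set T := y :: t.
have [/andP[/allP Sf /allP Tf]|] := boolP (_ && _); last by [].
rewrite lt0b; apply/hasPn => z /Tf; rewrite oppr_gt0 => fz.
by apply/negP => /Sf; rewrite ltNge ltW.
Qed.

End Eigenfunction.

Hypothesis Psym : forall x y, P x y = P y x.

Local Notation H N := (\tr (green P N *m green P N)).

(* Integrate the pointwise bound 2 th Z - (th Z)^2 <= 1_(Z > 0). *)
Lemma second_moment N : 0 < H N ->
  n%:R ^+ 2 * N.+1%:R ^+ 2 / (4 * H N) <= \sum_x \sum_y (1 - avoid P N x y).
Proof.
(* This value maximizes 2 th A - th^2 B for A = n (N+1)^2, the total first moment, and B = 4 (N+1)^2
   H N, the bound on the second one; the maximum is A^2 / B. *)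
move=> H_gt0; pose th : R := n%:R / (4 * H N).
have th_ge0 : 0 <= th by rewrite divr_ge0 // mulr_ge0 // ltW.
have -> : n%:R ^+ 2 * N.+1%:R ^+ 2 / (4 * H N) =
   2 * th * (n%:R * N.+1%:R ^+ 2) - th ^+ 2 * (4 * N.+1%:R ^+ 2 * H N).
  by rewrite /th; field; rewrite gt_eqF.
apply: (@le_trans _ _ (2 * th * (n%:R * N.+1%:R ^+ 2) - th ^+ 2 *
  \sum_x \sum_y pathE P N x (fun s => pathE P N y (fun t => meetings R s t ^+ 2)))).
  rewrite lerD2l lerN2 ler_wpM2l ?sqr_ge0 //; exact: meetings_L2.
rewrite -(sum_meetings Pst) // !mulr_sumr -sumrB; apply: ler_sum => x _.
rewrite !mulr_sumr -sumrB; apply: ler_sum => y _.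
rewrite -pathE_has // -!pathEZ -pathEB; apply: (pathE_le Pst) => s _.
rewrite -!pathEZ -pathEB; apply: (pathE_le Pst) => t _.
have [_|Hn] /= := boolP (has _ _).
  by have := sqr_ge0 (th * meetings R (x :: s) (y :: t) - 1); nra.
suff -> : meetings R (x :: s) (y :: t) = 0 by nra.
apply: big1 => u _; move/hasPn: Hn => Hn.
have [ut|/count_memPn ->] := boolP (u \in y :: t); last by rewrite mulr0.
by have /count_memPn -> := Hn _ ut; rewrite mul0r.
Qed.

(* If the walks meet at u at times i, j <= L, then given both paths up to these
   times the expected number of meetings is at least (green L ^ 2)_(u, u). *)
Lemma doob_meetings L (b : R) s t x y :
  (forall u, b <= (green P L *m green P L) u u) ->
  size s = (L + L)%N -> size t = (L + L)%N ->
  has (mem (take L.+1 (x :: s))) (take L.+1 (y :: t)) ->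
  b <= doob P (fun r => doob P (meetings R r) (y :: t)) (x :: s).
Proof.
move=> Hb sL tL /hasP[u ut us].
(* A visit to u among the first L + 1 of the 2L + 1 states leaves at least L further steps, enough
   to compare with [green P L]. *)
have split_at z r : size r = (L + L)%N -> u \in take L.+1 (z :: r) ->
    exists r1 r2, z :: r = r1 ++ u :: r2 /\ (L <= size r2)%N.
  move=> rL; case/splitPr Er : {1}_ / => [r1 r2].
  exists r1, (r2 ++ drop L.+1 (z :: r)).
  have E : z :: r = r1 ++ u :: r2 ++ drop L.+1 (z :: r).
    by rewrite -[LHS](cat_take_drop L.+1) Er -catA.
  split=> //; rewrite size_cat size_drop /= rL; lia.
have [s1 [s2 [-> s2L]]] := split_at _ _ sL us.
have [t1 [t2 [-> t2L]]] := split_at _ _ tL ut.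
apply: le_trans (le_doob _ _ _ _ _).
apply: (@le_trans _ _ (pathE P (size s2) u (fun r => pathE P (size t2) u
  (fun r' => meetings R r r')))).
  rewrite pathE_meetings //; apply: le_trans (Hb u) _.
  rewrite -sum_green_sqr //; apply: ler_sum => v _.
  by rewrite expr2 ler_pM ?green_ge0 ?green_mono.
apply: (pathE_le Pst) => r _; apply: le_trans (le_doob _ _ _ _ _).
apply: (pathE_le Pst) => r' _; apply: ler_sum => v _.
by rewrite -!natrM ler_nat leq_mul // !count_cat leq_addl.
Qed.

(** For a fixed path of Y the outer maximum is a Doob maximum along X, which costs a factor 4. After
    exchanging the expectations, the inner one is a Doob maximum along Y for a fixed path of X,
    which costs another 4. With the 4 of [meetings_L2] this makes 64. *)
Lemma cairoli L (b : R) : 0 <= b ->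
  (forall u, b <= (green P L *m green P L) u u) ->
  b ^+ 2 * \sum_x \sum_y (1 - avoid P L x y) <=
  64 * (L + L).+1%:R ^+ 2 * H (L + L).
Proof.
move=> b_ge0 Hb; set N := (L + L)%N.
pose D s t := doob P (fun r => doob P (meetings R r) t) s.
have step x y : b ^+ 2 * (1 - avoid P L x y) <=
    16 * pathE P N x (fun s => pathE P N y (fun t => meetings R s t ^+ 2)).
  apply: (@le_trans _ _ (pathE P N x (fun s => pathE P N y (fun t => D s t ^+ 2)))).
    rewrite -pathE_has // -(pathE_take Pst L L) -pathEZ; apply: (pathE_le Pst) => s sN.
    rewrite -(pathE_take Pst L L) -pathEZ; apply: (pathE_le Pst) => t tN.
    case E: (has _ _); last by rewrite mulr0 sqr_ge0.
    by rewrite mulr1 ler_sqr ?nnegrE ?doob_ge0 //; exact: doob_meetings E.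
  rewrite pathE_swap.
  apply: (@le_trans _ _ (pathE P N y (fun t => 4 *
      pathE P N x (fun s => doob P (meetings R s) t ^+ 2)))).
    by apply: (pathE_le Pst) => t _; exact: doob_L2.
  have -> : 16 = 4 * 4 :> R by rewrite -natrM.
  rewrite pathEZ -mulrA ler_wpM2l // pathE_swap -pathEZ.
  by apply: (pathE_le Pst) => s _; exact: doob_L2.
rewrite mulr_sumr; under eq_bigr do rewrite mulr_sumr.
apply: le_trans (ler_sum _ (fun x _ => ler_sum _ (fun y _ => step x y))) _.
under eq_bigr do rewrite -mulr_sumr.
rewrite -mulr_sumr.
have := meetings_L2 Pst Psym N; move: (H N) => h; lra.
Qed.

End Avoidance.

(** * Real symmetric matrices *)

Section SymmetricSpectrum.
Variables (R : realFieldType) (n : nat) (A : 'M[R]_n.+1).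
Hypothesis Asym : A^T = A.

Lemma trmx_horner (p : {poly R}) : (horner_mx A p)^T = horner_mx A p.
Proof.
elim/poly_ind: p => [|p c IHp]; first by rewrite rmorph0 trmx0.
rewrite rmorphD rmorphM /= horner_mx_X horner_mx_C.
rewrite linearD /= tr_scalar_mx trmx_mul IHp Asym; congr (_ + _).
by have := comm_mx_horner p (comm_mx_refl A).
Qed.

Lemma sym_sqr_eq0 (B : 'M[R]_n.+1) : B^T = B -> B * B = 0 -> B = 0.
Proof.
move=> Bsym BB0; apply/matrixP => i j; rewrite mxE; apply/eqP.
have Bs k : B k i = B i k by rewrite -[in LHS]Bsym mxE.
have := congr1 (fun M : 'M[R]_n.+1 => M i i) BB0; rewrite !mxE.
under eq_bigr do rewrite Bs -expr2.
move=> /eqP; rewrite psumr_eq0 => [/allP/(_ j (mem_index_enum _))|k _].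
  by rewrite sqrf_eq0.
exact: sqr_ge0.
Qed.

Lemma sym_nilpotent (B : 'M[R]_n.+1) m : B^T = B -> B ^+ m = 0 -> B = 0.
Proof.
move=> Bsym Bm0; have BX k : (B ^+ k)^T = B ^+ k.
  by elim: k => [|k IHk]; rewrite ?expr0 ?trmx1 // [in LHS]exprS trmx_mul IHk Bsym [RHS]exprSr.
(* Raise the exponent to a power of two, so that [sym_sqr_eq0] can halve it repeatedly. *)
have : B ^+ (2 ^ m) = 0.
  by rewrite -(subnK (ltnW (ltn_expl m (ltnSn 1)))) exprD Bm0 mulr0.
elim: {Bm0}m => [//|m IHm]; rewrite expnS mul2n -addnn exprD => /sym_sqr_eq0.
by move=> /(_ (BX _)).
Qed.

(** Let p be the product of the distinct factors of the characteristic polynomial. That polynomial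
    divides a power of p, so p(A) is nilpotent by Cayley-Hamilton; being symmetric, it vanishes.
    Hence A is diagonalizable, and similarity together with unique factorization identifies the
    diagonal with [lam], multiplicities included. *)
Lemma sym_spectral (lam : seq R) :
  char_poly A = \prod_(l <- lam) ('X - l%:P) ->
  exists U (d : 'rV[R]_n.+1), [/\ U \in unitmx, U *m A = diag_mx d *m U
    & perm_eq [seq d 0 i | i <- enum 'I_n.+1] lam].
Proof.
move=> charA; pose p : {poly R} := \prod_(l <- undup lam) ('X - l%:P).
have dvdp_exp (s : seq R) : {subset s <= lam} ->
    \prod_(l <- s) ('X - l%:P) %| p ^+ size s.
  elim: s => [|l s IHs] sl; first by rewrite big_nil dvd1p.
  rewrite big_cons exprS dvdp_mul //; last first.
    by apply: IHs => z zs; apply: sl; rewrite inE zs orbT.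
  by rewrite dvdp_XsubCl root_prod_XsubC mem_undup sl ?mem_head.
have pA0 : horner_mx A p = 0.
  apply: (@sym_nilpotent _ (size lam)); first exact: trmx_horner.
  rewrite -rmorphXn /=; have /dvdpP[q ->] := dvdp_exp lam (fun _ => id).
  by rewrite -charA rmorphM /= Cayley_Hamilton mulr0.
have [U Uunit] : diagonalizable A.
  by apply/diagonalizableP; exists (undup lam); rewrite ?undup_uniq // mxminpoly_min.
move=> /diagonalizable_forPex[d /(simmxP Uunit) UA].
exists U, d; split=> //; apply: prod_XsubC_eq; rewrite -charA big_map.
have charD : char_poly (diag_mx d) = \prod_(i <- enum 'I_n.+1) ('X - (d 0 i)%:P).
  rewrite char_poly_trig ?diag_mx_is_trig // big_enum /=.
  by apply: eq_bigr => i _; rewrite mxE eqxx.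
rewrite -charD; pose V := map_mx polyC U.
have VA : V *m char_poly_mx A = char_poly_mx (diag_mx d) *m V.
  rewrite /char_poly_mx mulmxBr mulmxBl mul_mx_scalar mul_scalar_mx.
  by rewrite -!map_mxM UA.
have V_neq0 : \det V != 0.
  by rewrite det_map_mx polyC_eq0 -unitfE -unitmxE.
apply: (mulfI V_neq0); rewrite /char_poly mulrC.
by rewrite -det_mulmx -VA det_mulmx.
Qed.

Lemma mxtrace_exp_diag (U : 'M[R]_n.+1) d t : U \in unitmx ->
  U *m A = diag_mx d *m U -> \tr (A ^+ t) = \sum_i d 0 i ^+ t.
Proof.
move=> Uunit UA.
have UAt : U *m A ^+ t = diag_mx (\row_i d 0 i ^+ t) *m U.
  elim: t => [|t IHt].
    rewrite expr0 mulmx1 -[LHS]mul1mx -diag_const_mx; congr (diag_mx _ *m _).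
    by apply/rowP => i; rewrite !mxE expr0.
  rewrite exprSr mulmxA IHt -mulmxA UA mulmxA mulmx_diag; congr (diag_mx _ *m _).
  by apply/rowP => i; rewrite !mxE exprSr.
rewrite -[A ^+ t](mulKmx Uunit) UAt mxtrace_mulC mulmxK // mxtrace_diag.
by apply: eq_bigr => i _; rewrite mxE.
Qed.

End SymmetricSpectrum.

(** * Transitive reversible chains *)

Section TransitiveChain.
Variables (R : realType) (n : nat).
Implicit Types (P : 'M[R]_n.+1) (x y z : 'I_n.+1).

Lemma argmax_exists (f : 'I_n.+1 -> R) : exists x, forall y, f y <= f x.
Proof.
have [x _ Hx] := arg_maxP (P := predT) f (erefl : predT (ord0 : 'I_n.+1)).
by exists x => y; exact: Hx.
Qed.

Lemma trmx_exp P t : (P ^+ t)^T = P^T ^+ t.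
Proof.
by elim: t => [|t IHt]; rewrite ?expr0 ?trmx1 // exprS trmx_mul IHt [RHS]exprSr.
Qed.

(** Maximum principle: at a maximizer x0, the nonnegative numbers f x0 - f z average to 0 under
    every power of P, and irreducibility gives each z positive weight in some power. *)
Lemma harmonic_const P (f : 'I_n.+1 -> R) : stochastic P -> irreducible P ->
  (forall x, \sum_y P x y * f y = f x) -> forall x y, f x = f y.
Proof.
move=> Pst Pirr Pf; have PfX t x : \sum_y (P ^+ t) x y * f y = f x.
  elim: t x => [|t IHt] x.
    rewrite (bigD1 x) //= expr0 mxE eqxx mul1r big1 ?addr0 // => y /negPf yx.
    by rewrite mxE eq_sym yx mul0r.
  under eq_bigr do rewrite exprS mxE mulr_suml.
  rewrite exchange_big /= -[RHS]Pf; apply: eq_bigr => z _.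
  by rewrite -IHt mulr_sumr; apply: eq_bigr => y _; rewrite mulrA.
have [x0 fx0] := argmax_exists f.
suff H y : f y = f x0 by move=> x y; rewrite !H.
have [t Pt] := Pirr x0 y; have Ptst := stochastic_exp t Pst.
have : \sum_z (P ^+ t) x0 z * (f x0 - f z) == 0.
  under eq_bigr do rewrite mulrBr.
  by rewrite sumrB PfX -mulr_suml Ptst.2 mul1r subrr.
rewrite psumr_eq0 => [|z _]; last by rewrite mulr_ge0 ?Ptst.1 // subr_ge0.
move=> /allP/(_ y (mem_index_enum _)) /=.
by rewrite mulf_eq0 gt_eqF //= subr_eq0 => /eqP.
Qed.

Variables (P : 'M[R]_n.+1) (pi : 'rV[R]_n.+1).
Hypotheses (Pst : stochastic P) (Pirr : irreducible P)
  (Ptrans : transitive_chain P).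

Lemma transitive_exp t x y : (P ^+ t) x x = (P ^+ t) y y.
Proof.
have [phi [phi_bij <- Pphi]] := Ptrans x y.
suff H z w : (P ^+ t) z w = (P ^+ t) (phi z) (phi w) by [].
elim: t z w => [|t IHt] z w; first by rewrite expr0 !mxE (bij_eq phi_bij).
rewrite exprS !mxE [RHS](reindex phi) /=; last exact/onW_bij.
by apply: eq_bigr => u _; rewrite -Pphi -IHt.
Qed.

Lemma transitive_colsum x : \sum_z P z x = 1.
Proof.
have colsum_eq y : \sum_z P z y = \sum_z P z x.
  have [phi [phi_bij <- Pphi]] := Ptrans x y.
  rewrite (reindex phi) /=; last exact/onW_bij.
  by apply: eq_bigr => z _; rewrite -Pphi.
have : \sum_y \sum_z P z y = n.+1%:R.
  rewrite exchange_big /=; under eq_bigr do rewrite Pst.2.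
  by rewrite sumr_const card_ord.
under eq_bigr do rewrite colsum_eq.
rewrite sumr_const card_ord -[X in X = _]mulr_natr => H.
have n0 : n.+1%:R != 0 :> R by rewrite pnatr_eq0.
by apply: (mulIf n0); rewrite H mul1r.
Qed.

Hypotheses (Ppi : stationary P pi) (Prev : reversible P pi).

(** Since the column sums are 1, the transpose of P is again stochastic and irreducible, and pi is
    harmonic for it. *)
Lemma stationary_uniform x : pi ord0 x = n.+1%:R^-1.
Proof.
have [pi_ge0 pi_sum piP] := Ppi.
have PTst : stochastic P^T.
  split=> [y z|y]; first by rewrite mxE Pst.1.
  by under eq_bigr do rewrite mxE; exact: transitive_colsum.
have PTirr : irreducible P^T.
  by move=> y z; have [t Pt] := Pirr z y; exists t; rewrite -trmx_exp mxE.
have pic y : pi ord0 y = pi ord0 x.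
  apply: (harmonic_const PTst PTirr) => z.
  rewrite -[in RHS]piP mxE; apply: eq_bigr => w _.
  by rewrite mxE mulrC.
move: pi_sum; under eq_bigr do rewrite pic.
rewrite sumr_const card_ord -[X in X = _]mulr_natr => H.
have n0 : n.+1%:R != 0 :> R by rewrite pnatr_eq0.
by apply: (mulIf n0); rewrite H mulVf.
Qed.

Lemma reversible_sym x y : P x y = P y x.
Proof.
have n0 : n.+1%:R^-1 != 0 :> R by rewrite invr_eq0 pnatr_eq0.
by apply: (mulfI n0); have := Prev x y; rewrite !stationary_uniform.
Qed.

Lemma trmx_sym : P^T = P.
Proof. by apply/matrixP => x y; rewrite mxE reversible_sym. Qed.

Lemma green2E N x : (green P N *m green P N) x x =
  \sum_(i < N.+1) \sum_(j < N.+1) (P ^+ (i + j)) x x.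
Proof.
rewrite /green mulmx_suml summxE; apply: eq_bigr => i _.
by rewrite mulmx_sumr summxE; apply: eq_bigr => j _; rewrite exprD.
Qed.

Lemma green2_diag N x :
  (green P N *m green P N) x x = \tr (green P N *m green P N) / n.+1%:R.
Proof.
rewrite /mxtrace; under eq_bigr => y _.
  rewrite (_ : _ y y = (green P N *m green P N) x x); first over.
  rewrite !green2E; apply: eq_bigr => i _; apply: eq_bigr => j _.
  exact: transitive_exp.
by rewrite sumr_const card_ord -[X in _ = X / _]mulr_natr mulfK // pnatr_eq0.
Qed.

Variable lam : n.+1.-tuple R.
Hypotheses (Plam : ordered_eigenvalues P lam) (Plazy : lazy P).

Lemma eigenfunction j : exists2 f : 'I_n.+1 -> R,
  (forall x, \sum_y P x y * f y = tnth lam j * f x) & exists x, f x != 0.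
Proof.
have : eigenvalue P (tnth lam j).
  by rewrite eigenvalue_root_char Plam.1 root_prod_XsubC mem_tnth.
move=> /eigenvalueP[v vP v_neq0]; exists (v ord0) => [x|].
  have := congr1 (fun w : 'rV[R]_n.+1 => w ord0 x) vP; rewrite !mxE => <-.
  by apply: eq_bigr => y _; rewrite reversible_sym mulrC.
by have /rV0Pn[x] := v_neq0; exists x.
Qed.

(** With P = (P0 + I) / 2, an eigenfunction of P for l is one of P0 for 2 l - 1, and comparing
    values where |f| is largest gives |2 l - 1| <= 1. *)
Lemma eigenvalue_bounds j : 0 <= tnth lam j <= 1.
Proof.
have [f Pf [x0 fx0]] := eigenfunction j; set l := tnth lam j in Pf *.
have [P0 [P0st PP0]] := Plazy.
have P0f x : \sum_y P0 x y * f y = (2 * l - 1) * f x.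
  have : 2 * \sum_y P x y * f y = \sum_y P0 x y * f y + f x.
    rewrite PP0 mulr_sumr; under eq_bigr do rewrite !mxE mulrA mulVKf ?pnatr_eq0 // mulrDl.
    rewrite big_split /=; congr (_ + _).
    rewrite (bigD1 x) //= eqxx mul1r big1 ?addr0 // => y /negPf yx.
    by rewrite eq_sym yx mul0r.
  by rewrite Pf => H; rewrite mulrBl mul1r -mulrA H addrK.
have [x fx] := argmax_exists (fun x => `|f x|).
have fx_gt0 : 0 < `|f x| by apply: lt_le_trans (fx x0); rewrite normr_gt0.
have : `|2 * l - 1| * `|f x| <= `|f x|.
  rewrite -normrM -P0f; apply: le_trans (ler_norm_sum _ _ _) _.
  rewrite -[leRHS]mul1r -(P0st.2 x) mulr_suml; apply: ler_sum => y _.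
  by rewrite normrM ger0_norm ?P0st.1 // ler_wpM2l ?P0st.1.
rewrite ger_pMl // ler_norml; lra.
Qed.

Lemma eigenvalue_top : tnth lam ord0 = 1.
Proof.
apply/eqP; rewrite eq_le (andP (eigenvalue_bounds _)).2 /=.
have : 1 \in lam.
  rewrite -root_prod_XsubC -Plam.1 -eigenvalue_root_char; apply/eigenvalueP.
  exists (const_mx 1); last by apply/rV0Pn; exists ord0; rewrite mxE oner_eq0.
  apply/rowP => x; rewrite scale1r !mxE.
  by under eq_bigr do rewrite mxE mul1r; exact: transitive_colsum.
move=> /tnthP[j ->]; rewrite !(tnth_nth 0).
apply: (sorted_leq_nth _ _ _ Plam.2) => //.
- by move=> a b c /= ab bc; exact: le_trans bc ab.
- by move=> a; exact: lexx.
- by rewrite inE size_tuple.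
- by rewrite inE size_tuple.
Qed.

(** A second eigenvalue 1 would give two rows of the diagonalizing matrix U that are harmonic, hence
    constant, hence proportional, against the invertibility of U. *)
Lemma eigenvalue_lt1 (j : 'I_n.+1) : (0 < j)%N -> tnth lam j < 1.
Proof.
move=> j_gt0; rewrite lt_neqAle (andP (eigenvalue_bounds j)).2 andbT.
apply/eqP => lamj1.
have [U [d [Uunit UP dlam]]] := sym_spectral trmx_sym Plam.1.
have : (1 < #|[pred i | d ord0 i == 1%R]|)%N.
  have -> : #|[pred i | d ord0 i == 1%R]| = count_mem 1%R lam.
    rewrite -(permP dlam) count_map -sum1_count big_enum_cond /= sum1_card.
    by apply: eq_card => i; rewrite !inE.
  have -> : count_mem 1%R lam = #|[pred i | tnth lam i == 1%R]|.
    rewrite -[in LHS](map_tnth_enum lam) count_map -sum1_count big_enum_cond /= sum1_card.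
    by apply: eq_card => i; rewrite !inE.
  apply/card_gt1P; exists ord0, j; split; rewrite ?inE ?lamj1 ?eigenvalue_top //.
  by apply: contraTneq j_gt0 => <-.
move=> /card_gt1P[i [k]] [/eqP di /eqP dk ik].
have Uc a : d ord0 a = 1 -> forall x, U a x = U a ord0.
  move=> da x; apply: (harmonic_const Pst Pirr) => z.
  have := congr1 (fun M : 'M[R]_n.+1 => M a z) UP.
  rewrite mul_diag_mx !mxE da mul1r => <-.
  by apply: eq_bigr => y _; rewrite reversible_sym mulrC.
(* These coefficients cancel the constant rows i and k, so w U = 0. *)
pose w : 'rV[R]_n.+1 := U k ord0 *: delta_mx ord0 i - U i ord0 *: delta_mx ord0 k.
have wU : w *m U = 0.
  apply/rowP => x; rewrite /w mulmxBl -!scalemxAl -!rowE !mxE Uc // (Uc k) //.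
  by rewrite mulrC subrr.
have /rowP/(_ k) : w = 0 by rewrite -(mulmxK Uunit w) wU mul0mx.
rewrite !mxE !eqxx /= [k == i]eq_sym (negPf ik) mulr0 mulr1 sub0r => /eqP.
rewrite oppr_eq0 => /eqP Ui0.
have rowUi : row i U = 0 by apply/rowP => x; rewrite !mxE Uc.
have : delta_mx ord0 i = 0 :> 'rV[R]_n.+1.
  by rewrite -(mulmxK Uunit (delta_mx _ _)) -rowE rowUi mul0mx.
by move=> /rowP/(_ i); rewrite !mxE !eqxx => /eqP; rewrite oner_eq0.
Qed.

Lemma mxtrace_expE t : \tr (P ^+ t) = \sum_j tnth lam j ^+ t.
Proof.
have [U [d [Uunit UP dlam]]] := sym_spectral trmx_sym Plam.1.
rewrite (mxtrace_exp_diag t Uunit UP).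
transitivity (\sum_(l <- [seq d ord0 i | i <- enum 'I_n.+1]) l ^+ t).
  by rewrite big_map big_enum.
rewrite (perm_big _ dlam) /= -[in LHS](map_tnth_enum lam) big_map.
by rewrite big_enum.
Qed.

Lemma exp_diagE t x : n.+1%:R * (P ^+ t) x x = \sum_j tnth lam j ^+ t.
Proof.
rewrite -mxtrace_expE /mxtrace; under [RHS]eq_bigr do rewrite (transitive_exp t _ x).
by rewrite sumr_const card_ord [LHS]mulr_natl.
Qed.

Lemma green2_trace N :
  \tr (green P N *m green P N) = \sum_j (\sum_(i < N.+1) tnth lam j ^+ i) ^+ 2.
Proof.
rewrite /green mulmx_suml linear_sum /=.
under eq_bigr do rewrite mulmx_sumr linear_sum /=.
under eq_bigr => i _ do under eq_bigr => k _ do rewrite -[_ *m _]exprD mxtrace_expE.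
under eq_bigr => i _ do rewrite exchange_big /=.
rewrite exchange_big /=; apply: eq_bigr => j _.
rewrite expr2 mulr_suml; apply: eq_bigr => i _.
by rewrite mulr_sumr; apply: eq_bigr => k _; rewrite exprD.
Qed.

(** Summing the eigenvalue equation over all states shows that f has sum 0, because the columns sum
    to 1 and the eigenvalue is not 1. A nonzero f with sum 0 takes both signs. *)
Lemma eigenfunction_extrema (j : 'I_n.+1) : (0 < j)%N -> exists f x y,
  [/\ forall z, \sum_w P z w * f w = tnth lam j * f z,
      forall z, f z <= f x, forall z, f y <= f z, 0 < f x & f y < 0].
Proof.
move=> j_gt0; have [f Pf [z0 fz0]] := eigenfunction j.
have f_sum : \sum_z f z = 0.
  have : \sum_z \sum_w P z w * f w = \sum_w f w.
    rewrite exchange_big /=; apply: eq_bigr => w _.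
    by rewrite -mulr_suml transitive_colsum mul1r.
  under eq_bigr do rewrite Pf.
  rewrite -mulr_sumr => /eqP; rewrite -subr_eq0 -{2}[\sum_w f w]mul1r -mulrBl.
  by rewrite mulf_eq0 subr_eq0 lt_eqF ?eigenvalue_lt1 //= => /eqP.
have [x fx] := argmax_exists f; have [y fy] := argmax_exists (fun z => - f z).
exists f, x, y; split=> //; first by move=> z; rewrite -lerN2.
- rewrite ltNge; apply/negP => fx_le0.
  have : \sum_z - f z == 0 by rewrite sumrN f_sum oppr0.
  rewrite psumr_eq0 => [/allP/(_ z0 (mem_index_enum _))/=|z _].
    by rewrite oppr_eq0 (negPf fz0).
  by rewrite oppr_ge0 (le_trans (fx z)).
- rewrite ltNge; apply/negP => fy_ge0.
  have /eqP := f_sum.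
  rewrite psumr_eq0 => [/allP/(_ z0 (mem_index_enum _))/=|z _].
    by rewrite (negPf fz0).
  by rewrite (le_trans fy_ge0) // -lerN2.
Qed.

End TransitiveChain.

(** * Estimates in terms of Q *)

Section PowerSums.
Variable R : realType.
Implicit Types l : R.

(** This takes the place of exponential decay estimates. In the induction step, with a = t, the gap
    is (1 + a) (1 - l)^2. *)
Lemma exp_bernoulli l t : 0 <= l <= 1 -> l ^+ t * (1 + t%:R * (1 - l)) <= 1.
Proof.
move=> /andP[l0 l1]; elim: t => [|t IHt].
  by rewrite expr0 mul0r addr0 mulr1.
apply: le_trans IHt; rewrite exprSr -mulrA ler_wpM2l ?exprn_ge0 //.
rewrite -natr1; move: (t%:R) (ler0n R t) => a a0.
have : 0 <= (1 + a) * (1 - l) ^+ 2 by rewrite mulr_ge0 ?sqr_ge0 // addr_ge0.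
nra.
Qed.

Lemma geom_sum l N : (1 - l) * \sum_(i < N) l ^+ i = 1 - l ^+ N.
Proof. by rewrite -opprB mulNr -subrX1 opprB. Qed.

Lemma geom_sum_le l N : 0 <= l < 1 -> \sum_(i < N) l ^+ i <= (1 - l)^-1.
Proof.
move=> /andP[l0 l1]; have l1' : 0 < 1 - l by rewrite subr_gt0.
rewrite -(ler_pM2l l1') geom_sum mulfV ?gt_eqF //.
by rewrite lerBlDr lerDl exprn_ge0.
Qed.

Lemma le_geom_sum l (a : R) N : l < 1 -> l ^+ N <= a ->
  (1 - a) / (1 - l) <= \sum_(i < N) l ^+ i.
Proof.
move=> l1 la; have l1' : 0 < 1 - l by rewrite subr_gt0.
by rewrite ler_pdivrMr // mulrC geom_sum lerD2l lerN2.
Qed.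

Lemma geom_sum_double l L : 0 <= l <= 1 ->
  \sum_(i < (L + L).+1) l ^+ i <= 2 * \sum_(i < L.+1) l ^+ i.
Proof.
move=> /andP[l0 l1]; rewrite -addSn big_split_ord /= mulr2n mulrDl !mul1r lerD2l.
rewrite big_ord_recr /= -[leLHS]addr0 lerD ?exprn_ge0 //.
by apply: ler_sum => i _; rewrite exprD ler_piMl ?exprn_ge0 // exprn_ile1.
Qed.

End PowerSums.

Section Estimates.
Variables (R : realType) (n : nat).
Variables (P : 'M[R]_n.+1) (pi : 'rV[R]_n.+1) (lam : n.+1.-tuple R).
Hypotheses (n_gt0 : (0 < n)%N) (Pst : stochastic P) (Pirr : irreducible P)
  (Ptrans : transitive_chain P) (Ppi : stationary P pi) (Prev : reversible P pi)
  (Plam : ordered_eigenvalues P lam) (Plazy : lazy P).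
Implicit Types (x y z : 'I_n.+1) (j : 'I_n.+1).

Let Psym := reversible_sym Pst Pirr Ptrans Ppi Prev.
Let lam0 := eigenvalue_top Pst Pirr Ptrans Ppi Prev Plam Plazy.
Let lam_bounds := eigenvalue_bounds Pst Pirr Ptrans Ppi Prev Plam Plazy.
Let lam_lt1 := eigenvalue_lt1 Pst Pirr Ptrans Ppi Prev Plam Plazy.
Let Q := eigenvalue_sum lam.
Local Notation H N := (\tr (green P N *m green P N)).

Let lam_range j : (0 < j)%N -> 0 <= tnth lam j < 1.
Proof. by move=> j0; rewrite (andP (lam_bounds j)).1 lam_lt1. Qed.

Let nR_neq0 : n.+1%:R != 0 :> R. Proof. by rewrite pnatr_eq0. Qed.
Let nR_gt0 : 0 < n.+1%:R :> R. Proof. by rewrite ltr0n. Qed.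

Definition lam_sum t : R := \sum_(j < n.+1 | (0 < j)%N) tnth lam j ^+ t.

Lemma sum_ord_recl0 (F : 'I_n.+1 -> R) :
  \sum_j F j = F ord0 + \sum_(j < n.+1 | (0 < j)%N) F j.
Proof.
rewrite (bigD1 ord0) //=; congr (_ + _); apply: eq_bigl => j.
by rewrite lt0n.
Qed.

Lemma exp_diag_lam t x : n.+1%:R * (P ^+ t) x x = 1 + lam_sum t.
Proof.
by rewrite (exp_diagE Pst Pirr Ptrans Ppi Prev Plam) sum_ord_recl0 lam0 expr1n.
Qed.

Lemma green2_lam N : H N = N.+1%:R ^+ 2 +
  \sum_(j < n.+1 | (0 < j)%N) (\sum_(i < N.+1) tnth lam j ^+ i) ^+ 2.
Proof.
rewrite (green2_trace Pst Pirr Ptrans Ppi Prev Plam) sum_ord_recl0 lam0.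
under eq_bigr do rewrite expr1n.
by rewrite sumr_const card_ord.
Qed.

Lemma sum_sqr_le_Q N :
  \sum_(j < n.+1 | (0 < j)%N) (\sum_(i < N.+1) tnth lam j ^+ i) ^+ 2 <= Q.
Proof.
apply: ler_sum => j j0; have /andP[l0 l1] := lam_range j0.
rewrite -exprVn ler_sqr ?nnegrE ?sumr_ge0 ?invr_ge0 ?subr_ge0 ?(ltW l1) //.
  by apply: geom_sum_le; rewrite l0.
by move=> i _; rewrite exprn_ge0.
Qed.

Lemma green2_le N : H N <= N.+1%:R ^+ 2 + Q.
Proof. by rewrite green2_lam lerD2l sum_sqr_le_Q. Qed.

Lemma green2_gt0 N : 0 < H N.
Proof.
rewrite green2_lam ltr_pwDl ?exprn_gt0 // sumr_ge0 // => j _.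
exact: sqr_ge0.
Qed.

Lemma green2_double L : H (L + L) <= 4 * H L.
Proof.
rewrite !(green2_trace Pst Pirr Ptrans Ppi Prev Plam) mulr_sumr.
apply: ler_sum => j _; have -> : 4 = 2 ^+ 2 :> R by rewrite -natrX.
have S0 N : 0 <= \sum_(i < N) tnth lam j ^+ i.
  by rewrite sumr_ge0 // => i _; rewrite exprn_ge0 // (andP (lam_bounds j)).1.
rewrite -exprMn ler_sqr ?nnegrE ?mulr_ge0 //.
exact: geom_sum_double.
Qed.

(** Past the relaxation time Bernoulli's inequality makes the (N+1)-st powers at most 1/2, so each
    geometric sum is at least half of its limit; squaring gives the 4. *)
Lemma le_green2 N : (forall j, (0 < j)%N -> 1 <= N.+1%:R * (1 - tnth lam j)) ->
  Q <= 4 * H N.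
Proof.
move=> hN; apply: (@le_trans _ _ (4 *
    \sum_(j < n.+1 | (0 < j)%N) (\sum_(i < N.+1) tnth lam j ^+ i) ^+ 2)); last first.
  by rewrite green2_lam ler_wpM2l // lerDr exprn_ge0.
rewrite mulr_sumr; apply: ler_sum => j j0; have /andP[l0 l1] := lam_range j0.
have -> : 4 = 2 ^+ 2 :> R by rewrite -natrX.
have g_gt0 : 0 < 1 - tnth lam j by rewrite subr_gt0.
have half : tnth lam j ^+ N.+1 <= 2^-1.
  have := exp_bernoulli N.+1 (lam_bounds j); have := hN j j0.
  have : 0 <= tnth lam j ^+ N.+1 by rewrite exprn_ge0.
  by move: (_ ^+ N.+1) (N.+1%:R * _) => p q; nra.
have S := le_geom_sum l1 half.
rewrite -exprVn -exprMn ler_sqr ?nnegrE ?invr_ge0 ?(ltW g_gt0) //; last first.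
  by rewrite mulr_ge0 // sumr_ge0 // => i _; rewrite exprn_ge0.
rewrite -[leLHS](mulVKf (_ : 2 != 0 :> R)) ?pnatr_eq0 // ler_wpM2l //.
by apply: le_trans S; rewrite le_eqVlt; apply/orP; left; apply/eqP; field; rewrite gt_eqF.
Qed.

Lemma Q_ge1 : 1 <= Q.
Proof.
rewrite /Q /eigenvalue_sum (bigD1 ord_max) //=.
have /andP[l0 l1] := lam_range (n_gt0 : (0 < (ord_max : 'I_n.+1))%N).
rewrite -[leLHS]addr0; apply: lerD.
  rewrite -exprVn -[leLHS](expr1n _ 2) ler_sqr ?nnegrE ?invr_ge0 ?subr_ge0 ?(ltW l1) //.
  rewrite -(ler_pM2l (_ : 0 < 1 - tnth lam ord_max)) ?subr_gt0 //.
  by rewrite mulr1 mulfV ?subr_eq0 ?gt_eqF // gerBl.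
by rewrite sumr_ge0 // => j _; rewrite invr_ge0 exprn_ge0 // subr_ge0 (andP (lam_bounds j)).2.
Qed.

Lemma unif_distP (t : nat) (a : R) : 0 <= a ->
  unif_dist P pi t <= a <->
  forall x y, `|n.+1%:R * (P ^+ t) x y - 1| <= a.
Proof.
move=> a0; have E x y : (P ^+ t) x y / pi ord0 y - 1 = n.+1%:R * (P ^+ t) x y - 1.
  by rewrite (stationary_uniform Pst Pirr Ptrans Ppi) invrK mulrC.
split=> [Ha x y|Ha].
  rewrite -E; apply: le_trans Ha; rewrite /unif_dist.
  apply: le_trans (le_bigmax_cond _ _ (erefl : predT x)).
  exact: (le_bigmax_cond _ (fun y => `|(P ^+ t) x y / pi ord0 y - 1|) (erefl : predT y)).
apply/bigmax_leP; split=> // x _; apply/bigmax_leP; split=> // y _.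
by rewrite E.
Qed.

(* At even times P ^ (2r) - 1/n is a Gram matrix, hence dominated by its diagonal. *)
Lemma unif_dist_even r (a : R) : 0 <= a -> lam_sum (r + r) <= a ->
  unif_dist P pi (r + r) <= a.
Proof.
move=> a0 Ha; apply/unif_distP => // x y.
apply: le_trans Ha.
have Pr1 u : \sum_z (P ^+ r) u z = 1 by exact: (stochastic_exp r Pst).2.
pose B u v := (P ^+ r) u v - n.+1%:R^-1.
have key u v : n.+1%:R * (P ^+ (r + r)) u v - 1 = n.+1%:R * \sum_z B u z * B v z.
  have -> : \sum_z B u z * B v z = (P ^+ (r + r)) u v - n.+1%:R^-1.
    rewrite exprD mxE.
    transitivity (\sum_z ((P ^+ r) u z * (P ^+ r) z v
      - n.+1%:R^-1 * (P ^+ r) u z - n.+1%:R^-1 * (P ^+ r) v z + n.+1%:R^-1 ^+ 2)).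
      by apply: eq_bigr => z _; rewrite /B (sym_exp Psym r z v); ring.
    rewrite !big_split /= !sumrN -!mulr_sumr !Pr1 sumr_const card_ord -[_ *+ _]mulr_natl.
    by field.
  by rewrite mulrBr mulfV.
have diag u : lam_sum (r + r) = n.+1%:R * \sum_z B u z ^+ 2.
  have := key u u; rewrite exp_diag_lam addrC addKr => ->.
  by congr (_ * _); apply: eq_bigr => z _; rewrite expr2.
rewrite key normrM ger0_norm ?(ltW nR_gt0) //.
have : n.+1%:R * \sum_z (B x z ^+ 2 + B y z ^+ 2) = 2 * lam_sum (r + r).
  by rewrite big_split /= mulrDr -(diag x) -(diag y) mulr2n mulrDl !mul1r.
(* Both diagonal terms equal [lam_sum (r + r)], so 2 |a b| <= a^2 + b^2 is enough. *)
suff : 2 * `|\sum_z B x z * B y z| <= \sum_z (B x z ^+ 2 + B y z ^+ 2).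
  move: (`|\sum_z _|) (\sum_z (_ + _)) (n.+1%:R : R) nR_gt0 => p q m m0; nra.
apply: (@le_trans _ _ (\sum_z 2 * `|B x z * B y z|)).
  by rewrite -mulr_sumr ler_wpM2l // ler_norm_sum.
apply: ler_sum => z _; rewrite normrM.
have := sqr_ge0 (`|B x z| - `|B y z|).
rewrite -[B x z ^+ 2]real_normK ?num_real // -[B y z ^+ 2]real_normK ?num_real //.
nra.
Qed.

(** Ensures that [t_unif] is a genuine minimum and not the default value of [xget]. Bernoulli's
    inequality bounds l^(2r) by 1 / (r (1 - l)), so any r >= 4 A works. *)
Lemma unif_dist_ex : exists t, unif_dist P pi t <= 4^-1.
Proof.
pose A := \sum_(j < n.+1 | (0 < j)%N) (1 - tnth lam j)^-1.
have A_ge0 : 0 <= A.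
  by rewrite sumr_ge0 // => j _; rewrite invr_ge0 subr_ge0 (andP (lam_bounds j)).2.
pose r := (Num.trunc (4 * A)).+1; exists (r + r)%N; apply: unif_dist_even => //.
have rA : 4 * A <= r%:R by rewrite ltW // truncnS_gt.
have r_gt0 : 0 < r%:R :> R by rewrite ltr0n.
apply: (@le_trans _ _ (r%:R^-1 * A)); last first.
  by rewrite mulrC ler_pdivrMr //; lra.
rewrite /A mulr_sumr; apply: ler_sum => j j0; have /andP[l0 l1] := lam_range j0.
have g_gt0 : 0 < 1 - tnth lam j by rewrite subr_gt0.
rewrite -invfM; apply: (@le_trans _ _ (tnth lam j ^+ r)).
  by rewrite exprD ler_piMl ?exprn_ge0 // exprn_ile1 // ltW.
rewrite -[leRHS]mul1r ler_pdivlMr ?mulr_gt0 //.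
apply: le_trans (exp_bernoulli r (lam_bounds j)).
by rewrite ler_wpM2l ?exprn_ge0 // lerDr.
Qed.

Let T := t_unif P pi.

Lemma t_unifP : unif_dist P pi T <= 4^-1 /\
  forall s : nat, unif_dist P pi s <= 4^-1 -> (T <= s)%N.
Proof.
have [m Pm mmin] := ex_minnP unif_dist_ex.
rewrite /T /t_unif; case: xgetP => [t -> //|/(_ m)].
by case; split.
Qed.

Lemma t_unif_ge x y : 3 / (4 * n.+1%:R) <= (P ^+ T) x y.
Proof.
have /unif_distP := t_unifP.1 => /(_ (ltac:(by rewrite invr_ge0)) x y).
rewrite ler_norml => /andP[h _]; rewrite ler_pdivrMr ?mulr_gt0 //.
move: h; move: ((P ^+ T) x y) (n.+1%:R) => p m; lra.
Qed.

(** The diagonal deviation n P^T(x, x) - 1 is a sum of nonnegative powers, so it dominates each of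
    them. The exponent T + 1 is the number of terms in the sums of [green]. *)
Lemma lam_exp_t_unif j : (0 < j)%N -> tnth lam j ^+ T.+1 <= 4^-1.
Proof.
move=> j0; have /andP[l0 l1] := lam_range j0.
have /unif_distP := t_unifP.1 => /(_ (ltac:(by rewrite invr_ge0)) ord0 ord0).
rewrite exp_diag_lam addrC addKr => h.
apply: (@le_trans _ _ (tnth lam j ^+ T)).
  by rewrite exprS ler_piMl ?exprn_ge0 // ltW.
apply: le_trans (le_trans (ler_norm _) h).
rewrite /lam_sum (bigD1 j) //= lerDl sumr_ge0 // => k _.
by rewrite exprn_ge0 // (andP (lam_bounds k)).1.
Qed.

Lemma Q_le_green2 : Q <= 16 / 9 * H T.
Proof.
apply: (@le_trans _ _ (16 / 9 *
    \sum_(j < n.+1 | (0 < j)%N) (\sum_(i < T.+1) tnth lam j ^+ i) ^+ 2)); last first.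
  by rewrite green2_lam ler_wpM2l ?divr_ge0 // lerDr exprn_ge0.
rewrite mulr_sumr; apply: ler_sum => j j0; have /andP[l0 l1] := lam_range j0.
have g_gt0 : 0 < 1 - tnth lam j by rewrite subr_gt0.
(* 4/3 is the inverse of 1 - 1/4, the fraction of the geometric series reached by time T. *)
have -> : 16 / 9 = (4 / 3) ^+ 2 :> R by field.
have S := le_geom_sum l1 (lam_exp_t_unif j0).
rewrite -exprVn -exprMn ler_sqr ?nnegrE ?invr_ge0 ?(ltW g_gt0) //; last first.
  by rewrite mulr_ge0 ?divr_ge0 // sumr_ge0 // => i _; rewrite exprn_ge0.
have -> : (1 - tnth lam j)^-1 = 4 / 3 * ((1 - 4^-1) / (1 - tnth lam j)).
  by field; rewrite gt_eqF.
by rewrite ler_wpM2l ?divr_ge0.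
Qed.

(** The even time 2r just below T has not mixed, so [lam_sum (r + r)] exceeds 1/4. As powers
    decrease, (r+1)^2 l^(2r) is at most the square of the geometric sum up to r, whence (r+1)^2 / 4
    <= Q, while T <= 2 (r+1). *)
Lemma t_unif_sqr_le : T%:R ^+ 2 <= 16 * Q.
Proof.
case ET : T => [|T']; first by rewrite expr0n mulr_ge0 // (le_trans _ Q_ge1).
pose r := T'./2; have rT : (r + r <= T')%N by rewrite /r; lia.
have Tr : (T <= 2 * r.+1)%N by rewrite ET /r; lia.
have D : 4^-1 < lam_sum (r + r).
  have q0 : 0 <= 4^-1 :> R by rewrite invr_ge0.
  rewrite ltNge; apply/negP => /(unif_dist_even q0).
  by move=> /t_unifP.2; rewrite ET; lia.
have Qr : r.+1%:R ^+ 2 * lam_sum (r + r) <= Q.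
  apply: le_trans (sum_sqr_le_Q r); rewrite /lam_sum mulr_sumr.
  apply: ler_sum => j j0; have /andP[l0 l1] := lam_range j0.
  rewrite exprD -expr2 -exprMn ler_sqr ?nnegrE ?mulr_ge0 ?exprn_ge0 //; last first.
    by rewrite sumr_ge0 // => i _; rewrite exprn_ge0.
  rewrite mulr_natl -[X in _ *+ X](card_ord r.+1) -sumr_const; apply: ler_sum => i _.
  by rewrite ler_wiXn2l ?(ltW l1) // -ltnS.
have : T%:R <= 2 * r.+1%:R :> R by rewrite -natrM ler_nat.
rewrite -ET => ab; apply: (@le_trans _ _ ((2 * r.+1%:R) ^+ 2)).
  by rewrite ler_sqr ?nnegrE ?mulr_ge0.
rewrite exprMn; have := sqr_ge0 (r.+1%:R : R).
move: (r.+1%:R ^+ 2) (lam_sum _) D Qr => b c; nra.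
Qed.

Let Q_ge0 : 0 <= Q. Proof. exact: le_trans Q_ge1. Qed.
Local Notation q := (Num.sqrt Q).
Let q_sqr : q ^+ 2 = Q. Proof. by rewrite sqr_sqrtr. Qed.
Let q_ge1 : 1 <= q. Proof. by rewrite -[leLHS]sqrtr1 ler_wsqrtr // Q_ge1. Qed.
Let q_ge0 : 0 <= q. Proof. exact: sqrtr_ge0. Qed.

(** Since L + 1 exceeds q, H L <= 2 (L+1)^2 and the second moment bound is n^2 / 8. With a = 3 / (4
    n), each block of length T + L <= 5 q succeeds with probability at least (9/16) / 8 = 9/128, and
    5 * 128 / 9 < 72. *)
Lemma sum_avoid_upper K x y : \sum_(t < K) avoid P t x y <= 72 * q.
Proof.
pose L := Num.trunc q.
have /andP[Lq qL] : L%:R <= q < L.+1%:R by apply: truncn_itv.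
have L_gt0 : (0 < L)%N by rewrite truncn_gt0.
have H2 := second_moment Pst Psym (green2_gt0 L).
have HL : H L <= 2 * L.+1%:R ^+ 2.
  apply: le_trans (green2_le L) _; rewrite mulr2n mulrDl !mul1r lerD2l -q_sqr.
  by rewrite ler_sqr ?nnegrE // ltW.
have {}H2 : n.+1%:R ^+ 2 / 8 <= \sum_u \sum_v (1 - avoid P L u v).
  apply: le_trans H2; rewrite ler_pdivlMr ?mulr_gt0 ?green2_gt0 //.
  have := sqr_ge0 (n.+1%:R : R); move: (n.+1%:R ^+ 2) => m m0.
  by have := ler_wpM2l m0 HL; lra.
have mix u v : avoid P (T + L) u v <= 1 - 9 / 128.
  have a0 : 0 <= 3 / (4 * n.+1%:R) :> R by rewrite divr_ge0 // mulr_ge0.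
  apply: le_trans (avoid_mix Pst L u v a0 (@t_unif_ge)) _.
  rewrite lerD2l lerN2; apply: le_trans (ler_wpM2l (sqr_ge0 _) H2).
  by rewrite le_eqVlt; apply/orP; left; apply/eqP; field.
have d0 : 0 < 9 / 128 :> R by rewrite divr_gt0.
apply: le_trans (sum_avoid_le Pst _ d0 mix K x y) _; first by rewrite addn_gt0 L_gt0 orbT.
have Tq : T%:R <= 4 * q.
  rewrite -ler_sqr ?nnegrE ?mulr_ge0 // exprMn q_sqr.
  by apply: le_trans t_unif_sqr_le _; rewrite -natrX.
rewrite natrD ler_pdivrMr //; move: Tq Lq q_ge0.
move: (T%:R) (L%:R) q => a b c; lra.
Qed.

Lemma avoid_antitone M N x y : avoid P (M + N) x y <= avoid P M x y.
Proof.
apply: le_trans (avoid_cat Pst M N x y) _.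
apply: (pathE_le Pst) => s _; apply: (pathE_le Pst) => t _.
by rewrite ler_piMr ?ler0n ?avoid_le1.
Qed.

(** By [eigen_avoid] the avoidance probability at time t is at least l^t with l the squared
    eigenvalue. Stopping the series once l^K <= 1/2 loses a factor 2, and 1 - l <= 2 (1 - lambda)
    loses another. *)
Lemma sum_avoid_slow j : (0 < j)%N -> exists x y K,
  (1 - tnth lam j)^-1 / 4 <= \sum_(t < K) avoid P t x y.
Proof.
move=> j0; have /andP[l0 l1] := lam_range j0.
have g_gt0 : 0 < 1 - tnth lam j by rewrite subr_gt0.
have [f [x [y [Pf fx fy fx0 fy0]]]] :=
  eigenfunction_extrema Pst Pirr Ptrans Ppi Prev Plam Plazy j0.
have ex_avoid t := eigen_avoid Pst l0 t Pf fx fy fx0 fy0.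
pose l := tnth lam j ^+ 2.
have l_le : l <= tnth lam j by rewrite /l expr2 ler_piMl // ltW.
have l_ge0 : 0 <= l by rewrite exprn_ge0.
have l_lt1 : l < 1 by apply: le_lt_trans l_le l1.
pose K := (Num.trunc (1 - l)^-1).+1; exists x, y, K.
have hK : 1 <= K%:R * (1 - l).
  by rewrite -ler_pdivrMr ?subr_gt0 // div1r ltW // truncnS_gt.
have half : l ^+ K <= 2^-1.
  have := @exp_bernoulli R l K; rewrite l_ge0 (ltW l_lt1) => /(_ isT).
  have : 0 <= l ^+ K by rewrite exprn_ge0.
  by move: hK; move: (_ ^+ K) (K%:R * _) => a b; nra.
apply: (@le_trans _ _ (\sum_(t < K) l ^+ t)); last first.
  by apply: ler_sum => t _; apply: le_trans (ex_avoid t); rewrite -expr2 -!exprM mulnC.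
apply: le_trans (le_geom_sum l_lt1 half).
have g' : 0 < 1 - l by rewrite subr_gt0.
rewrite ler_pdivlMr // -mulrA ler_pdivrMl //.
rewrite /l; nra.
Qed.

Lemma sum_avoid_lower : exists x y K, q / 800 <= \sum_(t < K) avoid P t x y.
Proof.
have [slow|fast] := pselect (exists2 j : 'I_n.+1, (0 < j)%N & q / 200 <= (1 - tnth lam j)^-1).
  have [j j0 hj] := slow; have [x [y [K hK]]] := sum_avoid_slow j0.
  by exists x, y, K; apply: le_trans hK; lra.
have {}fast j : (0 < j)%N -> (1 - tnth lam j)^-1 < q / 200.
  by move=> j0; rewrite ltNge; apply/negP => h; apply: fast; exists j.
(* Each (1 - lambda)^-1 is at least 1, so in this case q > 200, and rounding q / 100 down loses at
   most half. *)
have q200 : 1 < q / 200.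
  have j0 : (0 < (ord_max : 'I_n.+1))%N by [].
  have /andP[l0 l1] := lam_range j0.
  apply: le_lt_trans (fast _ j0).
  by rewrite invf_ge1 ?subr_gt0 // gerBl.
pose m := Num.trunc (q / 100).
have /andP[mq qm] : m%:R <= q / 100 < m.+1%:R by apply: truncn_itv; lra.
have m_gt0 : (0 < m)%N by rewrite truncn_gt0; lra.
have mq' : q / 200 <= m%:R by move: qm; rewrite -[m.+1%:R]natr1; lra.
pose L := m.-1; have mL : L.+1 = m by rewrite prednK.
have QH : Q <= 4 * H L.
  apply: le_green2 => j j0; have /andP[l0 l1] := lam_range j0.
  rewrite mL -ler_pdivrMr ?subr_gt0 // div1r.
  by apply: ltW; apply: lt_le_trans (fast _ j0) mq'.
have b0 : 0 <= H L / n.+1%:R by rewrite divr_ge0 // ltW // green2_gt0.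
have diag u : H L / n.+1%:R <= (green P L *m green P L) u u.
  by rewrite (green2_diag Ptrans).
have := cairoli Pst Psym b0 diag.
set S := \sum_x _ => hS.
have S_le : S <= n.+1%:R ^+ 2 / 2.
  have h0 := green2_gt0 L; have h2 := green2_double L.
  have LL : (L + L).+1%:R <= 2 * m%:R :> R.
    by rewrite -mL -natrM ler_nat mul2n -addnn addSn ltnS addnS leqnSn.
  (* The final 4 comes from [green2_double]. One factor H L then cancels, and m <= q / 100 with Q <=
     4 H L leaves the constant 4 * 1024 / 10000 < 1/2. *)
  have {}hS : H L ^+ 2 * S <= n.+1%:R ^+ 2 * (64 * (2 * m%:R) ^+ 2 * (4 * H L)).
    have -> : H L ^+ 2 * S = n.+1%:R ^+ 2 * ((H L / n.+1%:R) ^+ 2 * S) by field.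
    rewrite ler_wpM2l ?sqr_ge0 //; apply: le_trans hS _.
    rewrite ler_pM ?mulr_ge0 ?sqr_ge0 ?(ltW (green2_gt0 _)) //.
    by rewrite ler_wpM2l // ler_sqr ?nnegrE ?mulr_ge0.
  have {}hS : H L * S <= n.+1%:R ^+ 2 * (1024 * m%:R ^+ 2).
    by rewrite -(ler_pM2l h0); move: hS; move: (n.+1%:R ^+ 2) (H L) => a h; lra.
  have m2 : m%:R ^+ 2 <= Q / 100 / 100.
    rewrite -q_sqr (_ : q ^+ 2 / 100 / 100 = (q / 100) ^+ 2); last by field.
    by rewrite ler_sqr ?nnegrE // divr_ge0.
  rewrite -(ler_pM2l h0); apply: le_trans hS _.
  rewrite [leRHS]mulrCA ler_wpM2l ?sqr_ge0 //; lra.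
(* Averaging: S is the sum of the meeting probabilities over n^2 pairs. *)
have [x [y hxy]] : exists x y, 2^-1 <= avoid P L x y.
  apply: contrapT => hn.
  have lt_half x y : 2^-1 < 1 - avoid P L x y.
    have : avoid P L x y < 2^-1 by rewrite ltNge; apply/negP => h; apply: hn; exists x, y.
    by lra.
  have : \sum_(x < n.+1) \sum_(y < n.+1) (2^-1 : R) < S.
    apply: ltr_sum => [|x _]; first by apply/hasP; exists ord0.
    by apply: ltr_sum => [|y _] //; apply/hasP; exists ord0.
  rewrite !sumr_const !card_ord ltNge => /negP; apply; apply: le_trans S_le _.
  by rewrite -mulrnA -[leRHS]mulr_natl natrM expr2.
exists x, y, m; apply: (@le_trans _ _ (\sum_(t < m) (2^-1 : R))).
  by rewrite sumr_const card_ord -[leRHS]mulr_natl; lra.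
apply: ler_sum => t _; apply: le_trans hxy _.
have tL : (t <= L)%N by rewrite -ltnS mL.
by rewrite -(subnKC tL) avoid_antitone.
Qed.

Lemma double_green_bounds x :
  35^-1 * (n.+1%:R * double_green_sum P pi x) <= Q /\
  Q <= 16 / 9 * (n.+1%:R * double_green_sum P pi x).
Proof.
have -> : n.+1%:R * double_green_sum P pi x = H T.
  rewrite /double_green_sum -green2E (green2_diag Ptrans).
  by rewrite mulrC divfK.
split; last exact: Q_le_green2.
rewrite ler_pdivrMl //; apply: le_trans (green2_le T) _.
have := t_unif_sqr_le; have := Q_ge1; rewrite -[T.+1%:R]natr1.
(* (T+1)^2 <= 2 T^2 + 2 <= 34 Q, and the remaining Q makes 35. *)
have := sqr_ge0 (T%:R - 1 : R); move: (T%:R : R) => a; nra.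
Qed.

End Estimates.

(** * Laws of the processes *)

Section PathLaw.
Variables (R : realType) (n : nat) (P : 'M[R]_n).
Variables (d : measure_display) (Omega : measurableType d) (mu : probability Omega R).
Implicit Types (X Y : nat -> Omega -> 'I_n) (x y : 'I_n) (u : nat -> 'I_n) (t : nat).

Lemma mkseqSl (T : Type) (f : nat -> T) k :
  mkseq f k.+1 = f 0%N :: mkseq (fun i => f i.+1) k.
Proof. by rewrite /mkseq /= -[1%N]/(1 + 0)%N iotaDl -map_comp. Qed.

Lemma pathE_word t x u :
  pathE P t x (fun s => (s == mkseq u t.+1)%:R) =
  (x == u 0%N)%:R * \prod_(k < t) P (u k) (u k.+1).
Proof.
elim: t x u => [|t IHt] x u.
  by rewrite big_ord0 mulr1 /= eqseq_cons andbT.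
rewrite /= big_ord_recl /=.
transitivity (\sum_y (P x y * ((x == u 0%N)%:R * ((y == u 1%N)%:R *
    \prod_(k < t) P (u k.+1) (u k.+2))))).
  apply: eq_bigr => y _; congr (_ * _).
  rewrite -[_ * \prod_(k < t) _](IHt y (fun k => u k.+1)) -pathEZ.
  apply: eq_pathE => s _.
  by rewrite [in LHS]mkseqSl eqseq_cons -natrM mulnb.
move: (\prod_(k < t) _) => p.
rewrite (bigD1 (u 1%N)) //= eqxx mul1r big1 ?addr0 => [|y /negPf yu]; last first.
  by rewrite yu mul0r !mulr0.
have [->|] := eqVneq x (u 0%N); first by rewrite !mul1r.
by rewrite !mul0r mulr0.
Qed.

Lemma path_eventS X t u :
  path_event X t.+1 u = path_event X t u `&` X t.+1 @^-1` [set u t.+1].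
Proof.
apply/seteqP; split=> [w Hw|w [Hw HwS] s].
  by split=> [s st|]; apply: Hw; rewrite // leqW.
by rewrite leq_eqVlt => /predU1P[->//|]; rewrite ltnS; exact: Hw.
Qed.

Lemma path_event0 X u : path_event X 0 u = X 0%N @^-1` [set u 0%N].
Proof.
apply/seteqP; split=> [w Hw|w Hw s]; first exact: Hw.
by rewrite leqn0 => /eqP ->.
Qed.

Lemma measurable_path_event X t u :
  (forall s y, measurable (X s @^-1` [set y])) -> measurable (path_event X t u).
Proof.
move=> mX; elim: t => [|t IHt]; first by rewrite path_event0.
by rewrite path_eventS; exact: measurableI.
Qed.

Lemma chain_path X x t u : markov_chain_from mu P x X ->
  mu (path_event X t u) = (pathE P t x (fun s => (s == mkseq u t.+1)%:R))%:E.
Proof.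
move=> [mX X0 XS]; rewrite pathE_word; elim: t => [|t IHt].
  rewrite big_ord0 mulr1 path_event0; have [<-//|xu] := eqVneq x (u 0%N).
  have mux0 : mu (~` (X 0%N @^-1` [set x])) = 0%E.
    by rewrite probability_setC // X0 subee.
  apply/eqP; rewrite eq_le measure_ge0 andbT -[leRHS]mux0.
  apply: le_measure; rewrite ?inE //; first exact: measurableC.
  by move=> w /= -> ux; rewrite ux eqxx in xu.
by rewrite XS IHt -EFinM big_ord_recr /= mulrA.
Qed.

Definition no_meeting X Y t : set Omega :=
  [set w | forall i j, (i <= t)%N -> (j <= t)%N -> X i w <> Y j w].

Definition path_word X t (w : Omega) : t.+1.-tuple 'I_n := mktuple (fun i : 'I_t.+1 => X i w).

Lemma path_wordE X t w : path_word X t w = mkseq (X^~ w) t.+1 :> seq 'I_n.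
Proof.
by rewrite /path_word /mkseq -val_enum_ord -map_comp.
Qed.

Lemma path_eventP X t (x0 : 'I_n) (s : t.+1.-tuple 'I_n) w :
  path_event X t (nth x0 s) w <-> path_word X t w = s.
Proof.
split=> [Hw|<- k kt].
  apply/val_inj; rewrite /= path_wordE; apply: (@eq_from_nth _ x0).
    by rewrite size_mkseq size_tuple.
  by rewrite size_mkseq => k kt; rewrite nth_mkseq //; exact: Hw.
by rewrite path_wordE nth_mkseq.
Qed.

Lemma mem_path_word X t w (z : 'I_n) :
  reflect (exists2 i, (i <= t)%N & X i w = z) (z \in path_word X t w).
Proof.
apply: (iffP (tnthP _ _)) => [[i ->]|[i it <-]].
  by exists i; rewrite ?tnth_mktuple // -ltnS.
by exists (Ordinal (it : (i < t.+1)%N)); rewrite tnth_mktuple.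
Qed.

Lemma no_meetingP X Y t w : no_meeting X Y t w <->
  ~~ has (mem (path_word X t w)) (path_word Y t w).
Proof.
split=> [Hw|/hasPn Hw i j it jt XY].
  apply/hasPn => z /mem_path_word[j jt Yj]; apply/negP => /mem_path_word[i it Xi].
  by apply: (Hw i j it jt); rewrite Xi Yj.
have Yj : Y j w \in path_word Y t w by apply/mem_path_word; exists j.
by apply: (negP (Hw _ Yj)); apply/mem_path_word; exists i.
Qed.

Lemma pathE_tuple N x (f : seq 'I_n -> R) : pathE P N x f =
  \sum_(s : N.+1.-tuple 'I_n) f s * pathE P N x (fun r => (r == s)%:R).
Proof.
under eq_bigr do rewrite -pathEZ.
rewrite -pathE_sum; apply: eq_pathE => r rN.
have rN' : size (x :: r) == N.+1 by rewrite /= rN.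
rewrite (bigD1 (Tuple rN')) //= eqxx mulr1 big1 ?addr0 // => s /negPf sr.
by rewrite eq_sym -val_eqE /= in sr; rewrite sr mulr0.
Qed.

(** Splits the event into finitely many intersections of path events, the only events for which
    independence is assumed. *)
Lemma indic_no_meeting X Y t (x0 : 'I_n) w :
  \1_(no_meeting X Y t) w =
  \sum_(p : t.+1.-tuple 'I_n * t.+1.-tuple 'I_n | ~~ has (mem p.1) p.2)
    \1_(path_event X t (nth x0 p.1) `&` path_event Y t (nth x0 p.2)) w :> R.
Proof.
pose p0 := (path_word X t w, path_word Y t w).
have E (p : t.+1.-tuple 'I_n * t.+1.-tuple 'I_n) :
    \1_(path_event X t (nth x0 p.1) `&` path_event Y t (nth x0 p.2)) w = (p == p0)%:R :> R.
  rewrite indicE; congr (_%:R); congr nat_of_bool.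
  apply/idP/eqP => [|->]; rewrite inE.
    by move=> [/path_eventP h1 /path_eventP h2]; rewrite /p0 h1 h2; case: p {h1 h2}.
  by split; apply/path_eventP.
under eq_bigr do rewrite E.
rewrite indicE; have [H|H] := boolP (~~ has (mem p0.1) p0.2).
  rewrite mem_set; last exact/no_meetingP.
  by rewrite (bigD1 p0) //= eqxx big1 ?addr0 // => p /andP[_ /negPf ->].
rewrite memNset; last by move/no_meetingP; apply/negP.
rewrite big1 // => p pp; case: eqP => // pp0; move: H.
by rewrite -pp0 pp.
Qed.

Lemma pathE_pair t x y (A : seq 'I_n -> seq 'I_n -> bool) :
  pathE P t x (fun s => pathE P t y (fun r => (A s r)%:R)) =
  \sum_(p : t.+1.-tuple 'I_n * t.+1.-tuple 'I_n | A p.1 p.2)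
    pathE P t x (fun s => (s == p.1)%:R) * pathE P t y (fun r => (r == p.2)%:R).
Proof.
rewrite pathE_tuple [RHS]big_mkcond.
rewrite -(pair_bigA _ (fun (s : t.+1.-tuple 'I_n) (r : t.+1.-tuple 'I_n) =>
  if A s r then pathE P t x (fun s' => (s' == s)%:R) *
    pathE P t y (fun r' => (r' == r)%:R) else 0)) /=.
apply: eq_bigr => s _; rewrite pathE_tuple mulr_suml; apply: eq_bigr => r _.
by case: (A s r); rewrite ?mul1r ?mul0r // mulrC.
Qed.

Lemma measurable_no_meeting X Y t :
  (forall s y, measurable (X s @^-1` [set y])) ->
  (forall s y, measurable (Y s @^-1` [set y])) -> measurable (no_meeting X Y t).
Proof.
move=> mX mY.
have -> : no_meeting X Y t = \bigcap_(i in `I_t.+1) \bigcap_(j in `I_t.+1)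
    ~` \bigcup_(z in [set: 'I_n]) (X i @^-1` [set z] `&` Y j @^-1` [set z]).
  apply/seteqP; split=> [w Hw i it j jt [z _ [/= Xz Yz]]|w Hw i j it jt XY].
    by apply: (Hw i j) => //; rewrite Xz Yz.
  by apply: (Hw i it j jt); exists (X i w).
apply: fin_bigcap_measurable => [|i _]; first exact: finite_II.
apply: fin_bigcap_measurable => [|j _]; first exact: finite_II.
apply: measurableC; apply: fin_bigcup_measurable => [|z _]; first exact: finite_finset.
exact: measurableI.
Qed.

Lemma prob_no_meeting X Y x y t : independent_chains_from mu P x y X Y ->
  (\int[mu]_w (\1_(no_meeting X Y t) w)%:E)%E = (avoid P t x y)%:E.
Proof.
move=> [cX cY iXY]; have [mX _ _] := cX; have [mY _ _] := cY.
pose F (p : t.+1.-tuple 'I_n * t.+1.-tuple 'I_n) :=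
  path_event X t (nth x p.1) `&` path_event Y t (nth x p.2).
have mF p : measurable (F p) by apply: measurableI; exact: measurable_path_event.
under eq_integral => w _ do
  rewrite (indic_no_meeting X Y t x) -sumEFin -big_filter.
rewrite ge0_integral_sum //; last first.
  move=> p; apply/measurable_realfun.measurable_EFinP.
  by apply: measurable_realfun.measurable_indic; exact: mF.
rewrite big_filter /avoid pathE_pair -sumEFin; apply: eq_bigr => p _.
rewrite (integral_indic _ measurableT (mF p)) setIT.
transitivity (mu (path_event X t (nth x p.1)) * mu (path_event Y t (nth x p.2)))%E.
  exact: iXY.
rewrite (chain_path _ _ cX) (chain_path _ _ cY) -EFinM.
have mk (s : t.+1.-tuple 'I_n) : mkseq (nth x s) t.+1 = s.
  by have := mkseq_nth x s; rewrite size_tuple.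
by rewrite !mk.
Qed.

(** Tail-sum formula: [no_meeting X Y t] is the event that [tau_I] exceeds t. Both sides are
    infinite when the trajectories never meet. *)
Lemma tau_I_series X Y w :
  tau_I R X Y w = (\sum_(0 <= t <oo) (\1_(no_meeting X Y t) w)%:E)%E.
Proof.
have [[t0 ht0]|none] := pselect (exists t, ~ no_meeting X Y t w).
  have ex : exists t, ~~ `[< no_meeting X Y t w >] by exists t0; apply/asboolPn.
  have [m /asboolPn hm mmin] := ex_minnP ex.
  have meetP t : (exists i j, [/\ (i <= t)%N, (j <= t)%N & X i w = Y j w]) <->
      (m <= t)%N.
    split=> [[i [j [it jt XY]]]|mt].
      apply: mmin; apply/asboolPn => /(_ i j it jt); exact.
    have : ~ no_meeting X Y t w.
      by move=> h; apply: hm => i j im jm; apply: h; exact: leq_trans mt.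
    move/existsNP => [i /existsNP[j]] /not_implyP[it /not_implyP[jt /contrapT XY]].
    by exists i, j.
  have -> : tau_I R X Y w = m%:R%:E.
    apply/eqP; rewrite eq_le; apply/andP; split.
      by apply: ereal_inf_lbound; exists m => //; apply/meetP.
    by apply: le_ereal_inf_tmp => _ [t /meetP mt <-]; rewrite lee_fin ler_nat.
  rewrite (nneseries_split 0 m); last by move=> k _; rewrite lee_fin.
  rewrite add0n eseries0 ?adde0; last first.
    move=> i mi _; rewrite indicE memNset // => h.
    by have /meetP[a [b [ai bi]]] := mi; exact: h.
  rewrite big_mkord sumEFin; congr (_%:E).
  rewrite -[m in LHS]card_ord -sumr_const; apply: eq_bigr => i _.
  rewrite indicE mem_set // => a b ai bi XY.
  have : (m <= i)%N by apply/meetP; exists a, b.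
  by rewrite leqNgt ltn_ord.
have all_no t : no_meeting X Y t w by apply: contrapT => h; apply: none; exists t.
have -> : tau_I R X Y w = +oo%E.
  rewrite /tau_I (_ : [set _ | _ in _] = set0) ?ereal_inf0 //.
  apply/seteqP; split=> // z [t [i [j [it jt XY]]] _].
  exact: (all_no t i j it jt XY).
apply/esym/eqyP => A A_gt0.
apply: le_trans (nneseries_lim_ge (Num.trunc A).+1 _); last by move=> k _ _; rewrite lee_fin.
rewrite big_mkord sumEFin lee_fin.
under eq_bigr do rewrite indicE mem_set //.
by rewrite sumr_const card_ord ltW // truncnS_gt.
Qed.

Lemma expected_tau_I X Y x y : independent_chains_from mu P x y X Y ->
  (\int[mu]_w tau_I R X Y w = \sum_(0 <= t <oo) (avoid P t x y)%:E)%E.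
Proof.
move=> cXY; have [[mX _ _] [mY _ _] _] := cXY.
under eq_integral do rewrite tau_I_series.
rewrite integral_nneseries //; last first.
  move=> t; apply/measurable_realfun.measurable_EFinP.
  by apply: measurable_realfun.measurable_indic; exact: measurable_no_meeting.
by apply: eq_eseriesr => t _; rewrite (prob_no_meeting _ cXY).
Qed.

End PathLaw.

Theorem theorem1p5 (R : realType) :
  exists c C : R, 0 < c /\ 0 < C /\
  forall (n : nat) (P : 'M[R]_n) (pi : 'rV[R]_n) (lam : n.-tuple R),
    (2 <= n)%N ->
    stochastic P -> irreducible P -> transitive_chain P -> lazy P ->
    stationary P pi -> reversible P pi ->
    ordered_eigenvalues P lam ->
    let Q := eigenvalue_sum lam in
    (forall (d : measure_display) (Omega : measurableType d)
       (X Y : nat -> Omega -> 'I_n)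
       (Pr : 'I_n -> 'I_n -> probability Omega R),
       (forall x y : 'I_n, independent_chains_from (Pr x y) P x y X Y) ->
       ((c * Num.sqrt Q)%:E <= t_I Pr X Y)%E /\
       (t_I Pr X Y <= (C * Num.sqrt Q)%:E)%E) /\
    (forall x : 'I_n,
       c * (n%:R * double_green_sum P pi x) <= Q /\
       Q <= C * (n%:R * double_green_sum P pi x)).
Proof.
(* The constants of [sum_avoid_lower] and [sum_avoid_upper]; they are weaker than the 1/35 and 16/9
   of [double_green_bounds]. *)
exists 800^-1, 72; split; first by rewrite invr_gt0 ltr0n.
split; first by rewrite ltr0n.
move=> [//|n] P pi lam n_ge2 Pst Pirr Ptrans Plazy Ppi Prev Plam Q.
have n_gt0 : (0 < n)%N by [].
split=> [d Omega X Y Pr cXY|x]; last first.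
  have [lo hi] := double_green_bounds n_gt0 Pst Pirr Ptrans Ppi Prev Plam Plazy x.
  have G_ge0 : 0 <= n.+1%:R * double_green_sum P pi x.
    rewrite mulr_ge0 // sumr_ge0 // => i _; rewrite sumr_ge0 // => j _.
    exact: (stochastic_exp _ Pst).1.
  split; [apply: le_trans lo | apply: le_trans hi _].
    by rewrite ler_wpM2r // lef_pV2 ?posrE ?ltr0n // ler_nat.
  by rewrite ler_wpM2r //; lra.
split.
- have [x [y [K hK]]] := sum_avoid_lower n_gt0 Pst Pirr Ptrans Ppi Prev Plam Plazy.
  apply: (@le_trans _ _ (\int[Pr x y]_w tau_I R X Y w)%E).
    rewrite (expected_tau_I (cXY x y)).
    apply: le_trans (nneseries_lim_ge K _); last first.
      by move=> t _ _; rewrite lee_fin avoid_ge0.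
    by rewrite big_mkord sumEFin lee_fin mulrC.
  apply: le_trans (le_bigmax _ (fun x => \big[Order.max/0%E]_(y < n.+1)
    (\int[Pr x y]_w tau_I R X Y w)%E) x).
  exact: (le_bigmax _ (fun y => \int[Pr x y]_w tau_I R X Y w)%E y).
- have C_ge0 : (0 <= (72 * Num.sqrt Q)%:E)%E by rewrite lee_fin mulr_ge0 // sqrtr_ge0.
  apply/bigmax_leP; split=> // x _; apply/bigmax_leP; split=> // y _.
  rewrite (expected_tau_I (cXY x y)); apply: lime_le.
    by apply: is_cvg_nneseries => t _ _; rewrite lee_fin avoid_ge0.
  apply: nearW => K; rewrite big_mkord sumEFin lee_fin.
  exact: (sum_avoid_upper n_gt0 Pst Pirr Ptrans Ppi Prev Plam Plazy).
Qed.
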